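(* Let $A$ be a dg-algebra over a commutative unital ring $k$, let $U\in\mathbf{D}(A,d)$, and let $B=\mathrm{DgEnd}_A(U)$ be its dg-endomorphism algebra. The following are equivalent: (a) $A\in\mathrm{thick}(U)$ in $\mathbf{D}(A,d)$; (b) $U\in\mathrm{thick}(B)$ in $\mathbf{D}(B^{op},d)$, and $\delta_A:A\to\mathbb{R}\mathrm{Hom}_{B^{op}}(U,U)$ is an isomorphism in $\mathbf{D}(A,d)$.
   Context: $\mathbf{D}(A,d)$ is the derived category of right dg-$A$-modules, and $\mathbf{D}(B^{op},d)$ is the derived category of left dg-$B$-modules. The dg-endomorphism algebra $\mathrm{DgEnd}_A(U)$ is $\mathbb{R}\mathrm{Hom}_A(U,U)$, i.e. the dg-algebra $\mathrm{Hom}^\bullet_A(U',U')$ with $U'$ a cofibrant replacement of $U$; identifying $U$ with $U'$, $U$ becomes a dg-$B$-$A$-bimodule (left over $B$, right over $A$). The contravariant derived functors $\mathbb{R}\mathrm{Hom}_A(-,U):\mathbf{D}(A,d)\rightleftarrows\mathbf{D}(B^{op},d):\mathbb{R}\mathrm{Hom}_{B^{op}}(-,U)$ form a right adjoint pair with unit $\delta:1_{\mathbf{D}(A,d)}\to\mathbb{R}\mathrm{Hom}_{B^{op}}(\mathbb{R}\mathrm{Hom}_A(-,U),U)$, and $\delta_A$ is its value at $A$ (using $\mathbb{R}\mathrm{Hom}_A(A,U)\cong U$). For an object $X$ of a triangulated category, $\mathrm{thick}(X)$ is the smallest full triangulated subcategory containing $X$ and closed under direct summands. *)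

(* Defs.v *)
From HB Require Import structures.
From mathcomp Require Import all_boot all_algebra.
From mathcomp Require Import zify ring.
From mathcomp Require Import boolp.

Set Implicit Arguments.
Unset Strict Implicit.
Unset Printing Implicit Defensive.

Import GRing.Theory.
Local Open Scope ring_scope.
Local Obligation Tactic := idtac.

(** Conventions.  All gradings are by [int] and cohomological (differentials
    have degree +1).  To avoid casts between the components of degree
    [(i + j) + l] and [i + (j + l)], an operation of degree [n] from [M] to [N]
    is a family of maps [M p -> N q], one for each proof of [p + n = q].  Such
    proofs are unique because [int] has decidable equality, so no information
    is added. *)

Definition ksign (k : comPzRingType) (n : int) : k := (-1) ^+ `|n|%N.

Lemma ksign0 (k : comPzRingType) : ksign k 0 = 1.
Proof. by []. Qed.

Lemma ksignD (k : comPzRingType) (m n : int) :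
  ksign k (m + n) = ksign k m * ksign k n.
Proof.
rewrite /ksign -exprD -signr_odd -[RHS]signr_odd; congr (_ ^+ nat_of_bool _).
by lia.
Qed.

Lemma ksignS (k : comPzRingType) (m : int) : ksign k (m + 1) = - ksign k m.
Proof. by rewrite ksignD [ksign k 1]expr1 mulrN1. Qed.

Lemma ksignK (k : comPzRingType) (m : int) : ksign k m * ksign k m = 1.
Proof. by rewrite /ksign -exprD addnn -mul2n exprM sqrrN expr1n expr1n. Qed.

Record cplx (k : comPzRingType) := Cplx {
  ccar :> int -> lmodType k;
  cd : forall i j : int, i + 1 = j -> ccar i -> ccar j;
  cd_lin : forall i j (h : i + 1 = j), linear (cd h);
  cdd : forall i j l (h : i + 1 = j) (h' : j + 1 = l) x, cd h' (cd h x) = 0 }.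

Record dgalg (k : comPzRingType) := DgAlg {
  acx :> cplx k;
  amul : forall i j l : int, i + j = l -> acx i -> acx j -> acx l;
  aone : acx 0;
  amul_linl : forall i j l (h : i + j = l) y, linear (fun x => amul h x y);
  amul_linr : forall i j l (h : i + j = l) x, linear (amul h x);
  amulA : forall i j l ij jl ijl (h1 : i + j = ij) (h2 : ij + l = ijl)
      (h3 : j + l = jl) (h4 : i + jl = ijl) x y z,
    amul h2 (amul h1 x y) z = amul h4 x (amul h3 y z);
  amul1x : forall i (h : 0 + i = i) x, amul h aone x = x;
  amulx1 : forall i (h : i + 0 = i) x, amul h x aone = x;
  aleib : forall i j l i' j' l' (h : i + j = l) (hi : i + 1 = i')
      (hj : j + 1 = j') (hl : l + 1 = l') (h1 : i' + j = l') (h2 : i + j' = l')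
      x y,
    cd hl (amul h x y)
    = amul h1 (cd hi x) y + ksign k i *: amul h2 x (cd hj y) }.

Record is_dgact (k : comPzRingType) (A : dgalg k) (M : cplx k)
    (act : forall i j l : int, i + j = l -> M i -> A j -> M l) : Prop :=
  IsDgAct {
  dact_linl : forall i j l (h : i + j = l) a, linear (fun x => act i j l h x a);
  dact_linr : forall i j l (h : i + j = l) x, linear (act i j l h x);
  dactA : forall i j l ij jl ijl (h1 : i + j = ij) (h2 : ij + l = ijl)
      (h3 : j + l = jl) (h4 : i + jl = ijl) x a b,
    act ij l ijl h2 (act i j ij h1 x a) b
    = act i jl ijl h4 x (@amul k A j l jl h3 a b);
  dact1 : forall i (h : i + 0 = i) x, act i 0 i h x (aone A) = x;
  dleib : forall i j l i' j' l' (h : i + j = l) (hi : i + 1 = i')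
      (hj : j + 1 = j') (hl : l + 1 = l') (h1 : i' + j = l') (h2 : i + j' = l')
      x a,
    cd hl (act i j l h x a)
    = act i' j l' h1 (cd hi x) a + ksign k i *: act i j' l' h2 x (cd hj a) }.

(** Right dg-modules. *)
Record dgmod (k : comPzRingType) (A : dgalg k) := DgMod {
  mcx :> cplx k;
  mact : forall i j l : int, i + j = l -> mcx i -> A j -> mcx l;
  mactP : is_dgact mact }.

Section Linear.
Context (k : comPzRingType) (U V : lmodType k) (f : U -> V).
Hypothesis lf : linear f.
Lemma linD x y : f (x + y) = f x + f y.
Proof. by have := lf 1 x y; rewrite !scale1r. Qed.
Lemma lin0 : f 0 = 0.
Proof. by apply: (addrI (f 0)); rewrite -linD !addr0. Qed.
Lemma linZ a x : f (a *: x) = a *: f x.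
Proof. by have := lf a x 0; rewrite lin0 !addr0. Qed.
Lemma linN x : f (- x) = - f x.
Proof. by rewrite -scaleN1r linZ scaleN1r. Qed.
Lemma linB x y : f (x - y) = f x - f y.
Proof. by rewrite linD linN. Qed.
End Linear.

(** ** The opposite dg-algebra; left dg-modules are right modules over it

    [a *op b = (-1)^(|a||b|) b a].  A left dg-[B]-module is the same thing as a
    right dg-[dgop B]-module, through [x . b = (-1)^(|x||b|) b x]. *)

Section Op.
Context (k : comPzRingType) (A : dgalg k).

Lemma eq_addC (i j l : int) : i + j = l -> j + i = l.
Proof. by rewrite addrC. Qed.

Definition op_mul i j l (h : i + j = l) (x : A i) (y : A j) : A l :=
  ksign k (i * j) *: amul (eq_addC h) y x.

Lemma op_linl i j l (h : i + j = l) y : linear (fun x => op_mul h x y).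
Proof.
move=> a x x'; rewrite /op_mul (amul_linr (eq_addC h)) scalerDr !scalerA.
by rewrite mulrC.
Qed.

Lemma op_linr i j l (h : i + j = l) x : linear (op_mul h x).
Proof.
move=> a y y'; rewrite /op_mul (amul_linl (eq_addC h)) scalerDr !scalerA.
by rewrite mulrC.
Qed.

Lemma op_mulA i j l ij jl ijl (h1 : i + j = ij) (h2 : ij + l = ijl)
    (h3 : j + l = jl) (h4 : i + jl = ijl) x y z :
  op_mul h2 (op_mul h1 x y) z = op_mul h4 x (op_mul h3 y z).
Proof.
rewrite /op_mul (linZ (amul_linr _ _)) (linZ (amul_linl _ _)) !scalerA.
rewrite (amulA (eq_addC h3) (eq_addC h4) (eq_addC h1) (eq_addC h2)).
congr (_ *: _); rewrite -h1 -h3 !(mulrDl, mulrDr) !ksignD.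
ring.
Qed.

Lemma op_mul1x i (h : 0 + i = i) x : op_mul h (aone A) x = x.
Proof. by rewrite /op_mul mul0r ksign0 scale1r amulx1. Qed.

Lemma op_mulx1 i (h : i + 0 = i) x : op_mul h x (aone A) = x.
Proof. by rewrite /op_mul mulr0 ksign0 scale1r amul1x. Qed.

Lemma op_leib i j l i' j' l' (h : i + j = l) (hi : i + 1 = i')
      (hj : j + 1 = j') (hl : l + 1 = l') (h1 : i' + j = l') (h2 : i + j' = l')
      x y :
  cd hl (op_mul h x y)
  = op_mul h1 (cd hi x) y + ksign k i *: op_mul h2 x (cd hj y).
Proof.
rewrite /op_mul (linZ (cd_lin _)).
rewrite (aleib (eq_addC h) hj hi hl (eq_addC h2) (eq_addC h1)).
rewrite scalerDr !scalerA addrC; congr (_ *: _ + _ *: _).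
  by rewrite -hi mulrDl mul1r ksignD.
by rewrite -hj mulrDr mulr1 ksignD mulrCA ksignK mulr1.
Qed.

Definition dgop : dgalg k :=
  DgAlg op_linl op_linr op_mulA op_mul1x op_mulx1 op_leib.
End Op.

Definition dgreg (k : comPzRingType) (A : dgalg k) : dgmod A :=
  @DgMod k A A (@amul k A) (IsDgAct (@amul_linl k A) (@amul_linr k A)
    (@amulA k A) (@amulx1 k A) (@aleib k A)).

(** ** Homomorphism complexes *)

(** Homogeneous [A]-linear maps of degree [n], not necessarily commuting with
    the differentials. *)
Record hom (k : comPzRingType) (A : dgalg k) (M N : dgmod A) (n : int) := Hom {
  hf :> forall p q : int, p + n = q -> M p -> N q;
  hf_lin : forall p q (h : p + n = q), linear (hf h);
  hf_act : forall p q j p' q' (h : p + n = q) (hp : p + j = p')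
      (hq : q + j = q') (h' : p' + n = q') x a,
    hf h' (mact hp x a) = mact hq (hf h x) a }.

Lemma idx_comp (m n l p q r : int) :
  m + n = l -> p + l = q -> p + n = r -> r + m = q.
Proof. lia. Qed.

Section HomModule.
Context (k : comPzRingType) (A : dgalg k) (M N : dgmod A) (n : int).
Implicit Types f g : hom M N n.

Lemma homP f g : (forall p q (h : p + n = q) x, f p q h x = g p q h x) -> f = g.
Proof.
case: f g => [f fl fa] [g gl ga] /= e.
have {e} e : f = g.
  apply: functional_extensionality_dep => p.
  apply: functional_extensionality_dep => q.
  apply: functional_extensionality_dep => h.
  by apply: functional_extensionality_dep => x; apply: e.
by subst g; congr Hom; apply: Prop_irrelevance.
Qed.

Let actl := fun i j l h a => dact_linl (mactP N) (i:=i) (j:=j) (l:=l) h a.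

Program Definition hom0 : hom M N n := @Hom _ _ M N n (fun _ _ _ _ => 0) _ _.
Next Obligation. by move=> p q h a x y /=; rewrite scaler0 addr0. Qed.
Next Obligation. by move=> * /=; rewrite (lin0 (actl _ _)). Qed.

Program Definition homN f : hom M N n :=
  @Hom _ _ M N n (fun p q h x => - f p q h x) _ _.
Next Obligation.
by move=> f p q h a x y /=; rewrite (hf_lin f h) opprD scalerN.
Qed.
Next Obligation.
move=> f p q j p' q' h hp hq h' x a /=.
by rewrite (linN (actl _ _)) (hf_act f h hp hq).
Qed.

Program Definition homD f g : hom M N n :=
  @Hom _ _ M N n (fun p q h x => f p q h x + g p q h x) _ _.
Next Obligation.
by move=> f g p q h a x y /=; rewrite (hf_lin f h) (hf_lin g h) scalerDr addrACA.
Qed.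
Next Obligation.
move=> f g p q j p' q' h hp hq h' x a /=.
by rewrite (linD (actl _ _)) (hf_act f h hp hq) (hf_act g h hp hq).
Qed.

Program Definition homZ (c : k) f : hom M N n :=
  @Hom _ _ M N n (fun p q h x => c *: f p q h x) _ _.
Next Obligation.
by move=> c f p q h a x y /=; rewrite (hf_lin f h) scalerDr !scalerA mulrC.
Qed.
Next Obligation.
move=> c f p q j p' q' h hp hq h' x a /=.
by rewrite (linZ (actl _ _)) (hf_act f h hp hq).
Qed.

HB.instance Definition _ := gen_eqMixin (hom M N n).
HB.instance Definition _ := gen_choiceMixin (hom M N n).

Lemma homDA : associative homD.
Proof. by move=> f g e; apply: homP => * /=; rewrite addrA. Qed.
Lemma homDC : commutative homD.
Proof. by move=> f g; apply: homP => * /=; rewrite addrC. Qed.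
Lemma hom0D : left_id hom0 homD.
Proof. by move=> f; apply: homP => * /=; rewrite add0r. Qed.
Lemma homND : left_inverse hom0 homN homD.
Proof. by move=> f; apply: homP => * /=; rewrite addNr. Qed.

HB.instance Definition _ :=
  GRing.isZmodule.Build (hom M N n) homDA homDC hom0D homND.

Lemma homZA a b f : homZ a (homZ b f) = homZ (a * b) f.
Proof. by apply: homP => * /=; rewrite scalerA. Qed.
Lemma hom1Z : left_id 1 homZ.
Proof. by move=> f; apply: homP => * /=; rewrite scale1r. Qed.
Lemma homZDr : right_distributive homZ +%R.
Proof. by move=> a f g; apply: homP => * /=; rewrite scalerDr. Qed.
Lemma homZDl f : {morph homZ^~ f : a b / a + b}.
Proof. by move=> a b; apply: homP => * /=; rewrite scalerDl. Qed.

HB.instance Definition _ :=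
  GRing.Zmodule_isLmodule.Build k (hom M N n) homZA hom1Z homZDr homZDl.

Lemma homDE f g p q (h : p + n = q) x : (f + g) p q h x = f p q h x + g p q h x.
Proof. by []. Qed.
Lemma homZE c f p q (h : p + n = q) x : (c *: f) p q h x = c *: f p q h x.
Proof. by []. Qed.
Lemma hom0E p q (h : p + n = q) x : (0 : hom M N n) p q h x = 0.
Proof. by []. Qed.
End HomModule.

Section HomComplex.
Context (k : comPzRingType) (A : dgalg k) (M N : dgmod A).

(** [d f = d o f - (-1)^|f| f o d] *)
Definition hd_fun n n' (hn : n + 1 = n') (f : hom M N n) p q (h : p + n' = q)
    (x : M p) : N q :=
  cd (idx_comp (eq_addC hn) h erefl) (f p (p + n) erefl x)
  - ksign k n *: f (p + 1) q (idx_comp hn h erefl) (cd erefl x).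

Lemma hd_funE n n' (hn : n + 1 = n') (f : hom M N n) p q (h : p + n' = q) x
    r s (hr : p + n = r) (hr' : r + 1 = q) (hs : p + 1 = s) (hs' : s + n = q) :
  hd_fun hn f h x
  = cd hr' (f p r hr x) - ksign k n *: f s q hs' (cd hs x).
Proof.
case: _ / hr hr' => hr'; case: _ / hs hs' => hs'; rewrite /hd_fun.
rewrite (eq_irrelevance hr' (idx_comp (eq_addC hn) h erefl)).
by rewrite (eq_irrelevance hs' (idx_comp hn h erefl)).
Qed.

Lemma hd_lin n n' (hn : n + 1 = n') (f : hom M N n) p q (h : p + n' = q) :
  linear (hd_fun hn f h).
Proof.
move=> a x y; rewrite /hd_fun (hf_lin f) (cd_lin _) (cd_lin _) (hf_lin f).
by rewrite scalerDr opprD addrACA scalerDr scalerN !scalerA mulrC.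
Qed.

Lemma hd_act n n' (hn : n + 1 = n') (f : hom M N n) p q j p' q'
    (h : p + n' = q) (hp : p + j = p') (hq : q + j = q') (h' : p' + n' = q') x a :
  hd_fun hn f h' (mact hp x a) = mact hq (hd_fun hn f h x) a.
Proof.
have e1 : p + 1 + j = p' + 1 by lia.
have e2 : p + n + j = p' + n by lia.
have e3 : p + (j + 1) = p' + 1 by lia.
have e4 : p + n + (j + 1) = q' by lia.
have e5 : p + n + 1 = q by lia.
have e6 : p + 1 + n = q by lia.
have e7 : p' + n + 1 = q' by lia.
have e8 : p' + 1 + n = q' by lia.
rewrite (hd_funE hn f h x erefl e5 erefl e6).
rewrite (hd_funE hn f h' _ erefl e7 erefl e8).
rewrite (dleib (mactP M) hp erefl erefl _ e1 e3) (linD (hf_lin f _)).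
rewrite (linZ (hf_lin f _)) (hf_act f e6 e1 hq) (hf_act f erefl e3 e4).
rewrite (hf_act f erefl hp e2) (dleib (mactP N) e2 e5 erefl e7 hq e4).
rewrite (linB (dact_linl (mactP N) hq _)) (linZ (dact_linl (mactP N) hq _)).
by rewrite scalerDr !scalerA -ksignD (addrC n) opprD addrACA subrr addr0.
Qed.

Definition hd n n' (hn : n + 1 = n') (f : hom M N n) : hom M N n' :=
  Hom (hd_lin hn f) (hd_act hn f).

Lemma hd_linear n n' (hn : n + 1 = n') : linear (hd hn).
Proof.
move=> c f g; apply: homP => p q h x.
rewrite homDE homZE /= /hd_fun !homDE !homZE (cd_lin _) scalerDr opprD addrACA.
by rewrite scalerDr scalerN !scalerA mulrC.
Qed.

Lemma hdd n n' n'' (h : n + 1 = n') (h' : n' + 1 = n'') (f : hom M N n) :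
  hd h' (hd h f) = 0.
Proof.
apply: homP => p q e x; rewrite hom0E /=.
have e1 : p + n' + 1 = q by lia.
have e2 : p + 1 + n' = q by lia.
have e3 : p + n + 1 = p + n' by lia.
have e4 : p + 1 + n = p + n' by lia.
have e5 : p + 1 + 1 + n = q by lia.
rewrite (hd_funE h' (hd h f) e x erefl e1 erefl e2) /=.
rewrite (hd_funE h f erefl x erefl e3 erefl e4).
rewrite (hd_funE h f e2 (cd erefl x) e4 e1 erefl e5).
rewrite (linB (cd_lin _)) cdd (linZ (cd_lin _)) sub0r cdd.
rewrite (lin0 (hf_lin f _)) scaler0 subr0.
have -> : ksign k n' = - ksign k n by rewrite -h ksignS.
by rewrite scaleNr opprK addNr.
Qed.

Definition homcx : cplx k := @Cplx k (fun n => hom M N n) hd hd_linear hdd.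
End HomComplex.

(** ** Bimodules

    A dg-[B]-[A]-bimodule (left over [B], right over [A]) is encoded as a
    bimodule over [A] and [S := dgop B] acting both on the right: the relation
    [b (u a) = (b u) a] becomes [(u a) b = (-1)^(|a||b|) (u b) a]. *)
Record dgbimod (k : comPzRingType) (A S : dgalg k) := DgBimod {
  bcx :> cplx k;
  bact1 : forall i j l : int, i + j = l -> bcx i -> A j -> bcx l;
  bact2 : forall i j l : int, i + j = l -> bcx i -> S j -> bcx l;
  bact1P : is_dgact bact1;
  bact2P : is_dgact bact2;
  bactC : forall i j l ij il ijl (h1 : i + j = ij) (h2 : ij + l = ijl)
      (h3 : i + l = il) (h4 : il + j = ijl) x a s,
    bact2 h2 (bact1 h1 x a) s = ksign k (j * l) *: bact1 h4 (bact2 h3 x s) a }.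

Definition bimod1 (k : comPzRingType) (A S : dgalg k) (U : dgbimod A S) :
  dgmod A := DgMod (bact1P U).
Definition bimod2 (k : comPzRingType) (A S : dgalg k) (U : dgbimod A S) :
  dgmod S := DgMod (bact2P U).

Section Swap.
Context (k : comPzRingType) (A S : dgalg k) (U : dgbimod A S).
Lemma bactC_swap i j l ij il ijl (h1 : i + j = ij) (h2 : ij + l = ijl)
    (h3 : i + l = il) (h4 : il + j = ijl) (x : U i) s a :
  bact1 h2 (bact2 h1 x s) a = ksign k (j * l) *: bact2 h4 (bact1 h3 x a) s.
Proof. by rewrite (bactC h3 h4 h1 h2) scalerA (mulrC j) ksignK scale1r. Qed.

Definition bimod_swap : dgbimod S A :=
  @DgBimod k S A U (@bact2 _ _ _ U) (@bact1 _ _ _ U) (bact2P U) (bact1P U)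
    bactC_swap.
End Swap.

(** [Hom_A(M, U)] is a right dg-[S]-module:
    [(f s)(x) = (-1)^(|s||x|) f(x) s].  For [S = dgop B] this is the left
    [B]-action [(b f)(x) = b f(x)]; for the swapped bimodule, where [M] is a left
    dg-[B]-module, it is the right [A]-action [(f a)(x) = (-1)^(|a||x|) f(x) a]. *)
Section HomBimod.
Context (k : comPzRingType) (A S : dgalg k) (U : dgbimod A S) (M : dgmod A).

Lemma idx_act (n j l p q r : int) :
  n + j = l -> p + l = q -> p + n = r -> r + j = q.
Proof. lia. Qed.

Section Act.
Context (n j l : int) (e : n + j = l) (f : hom M (bimod1 U) n) (s : S j).

Definition ha_fun p q (h : p + l = q) (x : M p) : U q :=
  ksign k (j * p) *: bact2 (idx_act e h erefl) (f p (p + n) erefl x) s.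

Lemma ha_funE p q (h : p + l = q) x r (hr : p + n = r) (hr' : r + j = q) :
  ha_fun h x = ksign k (j * p) *: bact2 hr' (f p r hr x) s.
Proof.
case: _ / hr hr' => hr'; rewrite /ha_fun.
by rewrite (eq_irrelevance hr' (idx_act e h erefl)).
Qed.

Lemma ha_lin p q (h : p + l = q) : linear (ha_fun h).
Proof.
move=> a x y; rewrite /ha_fun (hf_lin f) (dact_linl (bact2P U)).
by rewrite scalerDr !scalerA mulrC.
Qed.

Lemma ha_act p q i p' q' (h : p + l = q) (hp : p + i = p')
    (hq : q + i = q') (h' : p' + l = q') x a :
  ha_fun h' (mact hp x a) = mact (d := bimod1 U) hq (ha_fun h x) a.
Proof.
have e1 : p + n + j = q by lia.
have e2 : p + n + i = p' + n by lia.
have e3 : p' + n + j = q' by lia.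
rewrite (ha_funE h x erefl e1) (ha_funE h' _ erefl e3).
rewrite (hf_act f erefl hp e2) /= (bactC e2 e3 e1 hq).
rewrite (linZ (dact_linl (bact1P U) _ _)) scalerA -hp mulrDr ksignD.
by rewrite (mulrC i) -mulrA ksignK mulr1.
Qed.

Definition ha : hom M (bimod1 U) l := @Hom k A M (bimod1 U) l ha_fun ha_lin ha_act.
End Act.

Lemma haP : @is_dgact k S (homcx M (bimod1 U)) ha.
Proof.
split.
- move=> i j l h a c x y; apply: homP => p q hp z.
  rewrite homDE homZE /= /ha_fun homDE homZE (dact_linl (bact2P U)).
  by rewrite scalerDr !scalerA mulrC.
- move=> i j l h x c a b; apply: homP => p q hp z.
  rewrite homDE homZE /= /ha_fun (dact_linr (bact2P U)).
  by rewrite scalerDr !scalerA mulrC.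
- move=> i j l ij jl ijl h1 h2 h3 h4 x a b; apply: homP => p q hp z /=.
  have e1 : p + i + j = p + ij by lia.
  have e2 : p + ij + l = q by lia.
  have e3 : p + i + jl = q by lia.
  rewrite (ha_funE _ _ _ _ _ erefl e2) /= (ha_funE _ _ _ _ _ erefl e1).
  rewrite (ha_funE _ _ _ _ _ erefl e3).
  rewrite (linZ (dact_linl (bact2P U) _ _)) (dactA (bact2P U) _ _ h3 e3).
  by rewrite scalerA -ksignD -mulrDl; congr (ksign k _ *: _); rewrite -h3 addrC.
- move=> i h x; apply: homP => p q hp z /=.
  rewrite (ha_funE _ _ _ _ _ hp (addr0 q)) mul0r ksign0 scale1r.
  by rewrite (dact1 (bact2P U)).
- move=> i j l i' j' l' h hi hj hl h1 h2 x a; apply: homP => p q hp z.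
  rewrite homDE homZE /=.
  have e1 : p + l + 1 = q by lia.
  have e2 : p + 1 + l = q by lia.
  have e3 : p + i' + j = q by lia.
  have e4 : p + i + 1 = p + i' by lia.
  have e5 : p + 1 + i = p + i' by lia.
  have e6 : p + i + j' = q by lia.
  have e7 : p + i + j = p + l by lia.
  rewrite (hd_funE _ _ _ _ erefl e1 erefl e2) /=.
  rewrite (ha_funE _ _ _ _ _ erefl e7) (ha_funE _ _ _ _ _ e5 e3).
  rewrite (ha_funE _ _ _ _ _ erefl e3) (ha_funE _ _ _ _ _ erefl e6) /=.
  rewrite (hd_funE _ _ _ _ erefl e4 erefl e5).
  rewrite (linZ (cd_lin _)) (dleib (bact2P U) e7 e4 hj e1 e3 e6).
  rewrite (linB (dact_linl (bact2P U) _ _)) (linZ (dact_linl (bact2P U) _ _)).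
  rewrite !scalerDr !scalerN !scalerA addrAC; congr (_ *: _ - _ *: _ + _ *: _).
    by rewrite -h ksignD mulrDr mulr1 ksignD -mulrA (mulrC (ksign k (j * p)))
      !mulrA -(mulrA (ksign k i)) ksignK mulr1 mulrC.
  by rewrite -hj mulrDl mul1r !ksignD; ring.
Qed.

Definition hom_bimod : dgmod S := DgMod haP.
End HomBimod.

(** ** The dg-endomorphism algebra of a dg-module *)
Section End.
Context (k : comPzRingType) (A : dgalg k) (M : dgmod A).

Section Comp.
Context (m n l : int) (e : m + n = l) (f : hom M M m) (g : hom M M n).

Definition hc_fun p q (h : p + l = q) (x : M p) : M q :=
  f (p + n) q (idx_act (eq_addC e) h erefl) (g p (p + n) erefl x).

Lemma hc_funE p q (h : p + l = q) x r (hr : p + n = r) (hr' : r + m = q) :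
  hc_fun h x = f r q hr' (g p r hr x).
Proof.
case: _ / hr hr' => hr'; rewrite /hc_fun.
by rewrite (eq_irrelevance hr' (idx_act (eq_addC e) h erefl)).
Qed.

Lemma hc_lin p q (h : p + l = q) : linear (hc_fun h).
Proof. by move=> a x y; rewrite /hc_fun (hf_lin g) (hf_lin f). Qed.

Lemma hc_act p q i p' q' (h : p + l = q) (hp : p + i = p')
    (hq : q + i = q') (h' : p' + l = q') x a :
  hc_fun h' (mact hp x a) = mact hq (hc_fun h x) a.
Proof.
have e1 : p + n + m = q by lia.
have e2 : p + n + i = p' + n by lia.
have e3 : p' + n + m = q' by lia.
rewrite (hc_funE h x erefl e1) (hc_funE h' _ erefl e3).
by rewrite (hf_act g erefl hp e2) (hf_act f e1 e2 hq).
Qed.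

Definition hc : hom M M l := @Hom k A M M l hc_fun hc_lin hc_act.
End Comp.
Arguments hc_fun : simpl never.

Lemma h1_lin p q (h : p + 0 = q) :
  linear (fun x : M p => ecast j (M j) (etrans (esym (addr0 p)) h) x).
Proof. by case: _ / (etrans _ _). Qed.

Lemma h1_act p q i p' q' (h : p + 0 = q) (hp : p + i = p')
    (hq : q + i = q') (h' : p' + 0 = q') (x : M p) a :
  ecast j (M j) (etrans (esym (addr0 p')) h') (mact hp x a)
  = mact hq (ecast j (M j) (etrans (esym (addr0 p)) h) x) a.
Proof.
case: _ / (etrans (esym (addr0 p')) h') hq => hq.
case: _ / (etrans (esym (addr0 p)) h) hq => hq.
by rewrite (eq_irrelevance hp hq).
Qed.

Definition h1 : hom M M 0 := @Hom k A M M 0 _ h1_lin h1_act.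

Lemma h1E p (h : p + 0 = p) x : h1 p p h x = x.
Proof. by rewrite /= (eq_irrelevance (etrans _ _) erefl). Qed.

Lemma hc_linl i j l (h : i + j = l) (y : hom M M j) : linear (fun x => hc h x y).
Proof. by move=> c x x'; apply: homP. Qed.

Lemma hc_linr i j l (h : i + j = l) (x : hom M M i) : linear (hc h x).
Proof.
move=> c y y'; apply: homP => p q e z.
by rewrite homDE homZE /= /hc_fun homDE homZE (hf_lin x).
Qed.

Lemma hcA i j l ij jl ijl (h1 : i + j = ij) (h2 : ij + l = ijl)
    (h3 : j + l = jl) (h4 : i + jl = ijl) (x : hom M M i) (y : hom M M j)
    (z : hom M M l) :
  hc h2 (hc h1 x y) z = hc h4 x (hc h3 y z).
Proof.
apply: homP => p q h t /=.
have e1 : p + l + ij = q by lia.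
have e2 : p + jl + i = q by lia.
have e3 : p + l + j = p + jl by lia.
rewrite (hc_funE _ _ _ _ _ erefl e1) /= (hc_funE _ _ _ _ _ e3 e2).
by rewrite (hc_funE _ _ _ _ _ erefl e2) /= (hc_funE _ _ _ _ _ erefl e3).
Qed.

Lemma hc1x i (h : 0 + i = i) (x : hom M M i) : hc h h1 x = x.
Proof.
apply: homP => p q e t /=.
by rewrite (hc_funE _ _ _ _ _ e (addr0 q)) h1E.
Qed.

Lemma hcx1 i (h : i + 0 = i) (x : hom M M i) : hc h x h1 = x.
Proof.
apply: homP => p q e t /=.
by rewrite (hc_funE _ _ _ _ _ (addr0 p) e) h1E.
Qed.

Lemma hc_leib i j l i' j' l' (h : i + j = l) (hi : i + 1 = i')
      (hj : j + 1 = j') (hl : l + 1 = l') (h1 : i' + j = l') (h2 : i + j' = l')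
      (x : hom M M i) (y : hom M M j) :
  hd hl (hc h x y) = hc h1 (hd hi x) y + ksign k i *: hc h2 x (hd hj y).
Proof.
apply: homP => p q e t; rewrite homDE homZE /=.
have e1 : p + l + 1 = q by lia.
have e2 : p + 1 + l = q by lia.
have e3 : p + j + i = p + l by lia.
have e4 : p + 1 + j = p + j' by lia.
have e5 : p + j' + i = q by lia.
have e6 : p + j + i' = q by lia.
have e7 : p + j + 1 = p + j' by lia.
rewrite (hd_funE _ _ _ _ erefl e1 erefl e2) /=.
rewrite (hc_funE _ _ _ _ _ erefl e3) (hc_funE _ _ _ _ _ e4 e5).
rewrite (hc_funE _ _ _ _ _ erefl e6) (hc_funE _ _ _ _ _ erefl e5) /=.
rewrite (hd_funE _ _ _ _ e3 e1 e7 e5) (hd_funE _ _ _ _ erefl e7 erefl e4).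
rewrite (linB (hf_lin x _)) (linZ (hf_lin x _)) scalerBr scalerA -ksignD h.
by rewrite addrA subrK.
Qed.

(** [Hom^*_A(M, M)], multiplied by composition. *)
Definition dgend : dgalg k :=
  @DgAlg k (homcx M M) hc h1 hc_linl hc_linr hcA hc1x hcx1 hc_leib.

(** [M] as a dg-[dgend M]-[A]-bimodule, by evaluation. *)
Definition end_act i j l (h : i + j = l) (x : M i) (b : dgop dgend j) : M l :=
  ksign k (i * j) *: (b : hom M M j) i l h x.

Lemma end_actP : is_dgact end_act.
Proof.
split.
- move=> i j l h b c x y; rewrite /end_act (hf_lin b h).
  by rewrite scalerDr !scalerA mulrC.
- move=> i j l h x c a b; rewrite /end_act.
  have -> : (c *: a + b : hom M M j) i l h x
    = c *: (a : hom M M j) i l h x + (b : hom M M j) i l h x by [].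
  by rewrite scalerDr !scalerA mulrC.
- move=> i j l ij jl ijl e1 e2 e3 e4 x a b; rewrite /end_act.
  have -> : (amul e3 a b : hom M M jl) i ijl e4 x
    = ksign k (j * l) *: hc_fun (eq_addC e3) b a e4 x by [].
  rewrite (hc_funE _ _ _ _ _ e1 e2) (linZ (hf_lin b _)) !scalerA.
  by congr (_ *: _); rewrite -e1 -e3 mulrDl mulrDr !ksignD; ring.
- by move=> i h x; rewrite /end_act mulr0 ksign0 scale1r; apply: h1E.
- move=> i j l i' j' l' e ei ej el e1 e2 x a; rewrite /end_act /=.
  rewrite (hd_funE _ _ _ _ e el ei e1) (linZ (cd_lin _)) scalerBr scalerBr.
  rewrite !scalerA.
  have -> : ksign k i * ksign k (i * j') = ksign k (i * j).
    by rewrite -ej mulrDr mulr1 ksignD mulrCA ksignK mulr1.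
  have -> : ksign k (i' * j) = ksign k (i * j) * ksign k j.
    by rewrite -ei mulrDl mul1r ksignD.
  by rewrite addrC subrK.
Qed.

Lemma end_actC i j l ij il ijl (e1 : i + j = ij) (e2 : ij + l = ijl)
    (e3 : i + l = il) (e4 : il + j = ijl) (x : M i) (a : A j)
    (b : dgop dgend l) :
  end_act e2 (mact e1 x a) b = ksign k (j * l) *: mact e4 (end_act e3 x b) a.
Proof.
rewrite /end_act (linZ (dact_linl (mactP M) _ _)) (hf_act b e3 e1 e4) scalerA.
by rewrite -ksignD -mulrDl -e1 addrC.
Qed.

Definition end_bimod : dgbimod A (dgop dgend) :=
  DgBimod (mactP M) end_actP end_actC.
End End.

(** ** Morphisms of dg-modules *)

Record dgmap (k : comPzRingType) (A : dgalg k) (M N : dgmod A) := DgMap {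
  mf :> forall i, M i -> N i;
  mf_lin : forall i, linear (@mf i);
  mf_d : forall i j (h : i + 1 = j) x, mf (cd h x) = cd h (mf x);
  mf_act : forall i j l (h : i + j = l) x a, mf (mact h x a) = mact h (mf x) a }.

Section Maps.
Context (k : comPzRingType) (A : dgalg k).
Implicit Types M N P : dgmod A.

Definition dgid M : dgmap M M.
Proof. by exists (fun _ x => x). Defined.

Definition dgcomp M N P (g : dgmap N P) (f : dgmap M N) : dgmap M P.
Proof.
exists (fun i x => g i (f i x)).
- by move=> i a x y; rewrite (mf_lin f) (mf_lin g).
- by move=> *; rewrite !mf_d.
- by move=> *; rewrite !mf_act.
Defined.

(** [H^i(f)] is injective and surjective for every [i]. *)
Definition quasi_iso M N (f : dgmap M N) : Prop :=
  (forall h i (e : h + 1 = i) (x : M i), cd (erefl (i + 1)) x = 0 ->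
     (exists y : N h, f i x = cd e y) -> exists x' : M h, x = cd e x') /\
  (forall h i (e : h + 1 = i) (y : N i), cd (erefl (i + 1)) y = 0 ->
     exists (x : M i) (z : N h), cd (erefl (i + 1)) x = 0 /\ y = f i x + cd e z).

(** Cofibrancy in the projective model structure, whose trivial fibrations are
    the degreewise surjective quasi-isomorphisms. *)
Definition cofibrant P : Prop :=
  forall (M N : dgmod A) (p : dgmap M N), (forall i y, exists x, p i x = y) ->
  quasi_iso p ->
  forall g : dgmap P N, exists f : dgmap P M, forall i x, p i (f i x) = g i x.

Record cofrepl M := CofRepl {
  crobj :> dgmod A;
  crmap : dgmap crobj M;
  cr_cofibrant : cofibrant crobj;
  cr_quasi_iso : quasi_iso crmap }.

(** ** Shift, direct sum and mapping cone *)

Lemma idx_shift (i j l : int) : i + j = l -> (i + 1) + j = l + 1.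
Proof. lia. Qed.

Definition shift M : dgmod A.
Proof.
pose C := @Cplx k (fun i => M (i + 1))
  (fun i j h x => - cd (idx_shift h) x).
unshelve refine (@DgMod k A (C _ _) (fun i j l h x a => mact (idx_shift h) x a) _).
- by move=> i j h a x y /=; rewrite (cd_lin _) opprD scalerN.
- by move=> i j l h h' x /=; rewrite (linN (cd_lin _)) cdd !oppr0.
split=> /=.
- by move=> *; apply: (dact_linl (mactP M)).
- by move=> *; apply: (dact_linr (mactP M)).
- by move=> *; apply: (dactA (mactP M)).
- by move=> *; apply: (dact1 (mactP M)).
- move=> i j l i' j' l' h hi hj hl h1 h2 x a.
  rewrite (dleib (mactP M) _ (idx_shift hi) hj _ (idx_shift h1) (idx_shift h2)).
  rewrite (linN (dact_linl (mactP M) _ _)) opprD; congr (_ + _).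
  by rewrite ksignS scaleNr opprK.
Defined.

Definition shiftf M N (f : dgmap M N) : dgmap (shift M) (shift N).
Proof.
exists (fun i (x : shift M i) => f (i + 1) x).
- by move=> i a x y; apply: (mf_lin f).
- by move=> i j h x /=; rewrite (linN (@mf_lin _ _ _ _ f _)) mf_d.
- by move=> i j l h x a; apply: (mf_act f).
Defined.

Lemma shiftf_quasi_iso M N (f : dgmap M N) :
  quasi_iso f -> quasi_iso (shiftf f).
Proof.
case=> inj sur; split=> h i e x /= /eqP; rewrite oppr_eq0 => /eqP dx.
- case=> y fx; have {}dx : cd (erefl (i + 1 + 1)) x = 0.
    by rewrite (eq_irrelevance erefl (idx_shift (erefl (i + 1)))).
  have [|x' ex] := inj (h + 1) (i + 1) (idx_shift e) x dx.
    by exists (- y); rewrite (linN (cd_lin _)).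
  by exists (- x'); rewrite (linN (cd_lin _)) opprK.
- have {}dx : cd (erefl (i + 1 + 1)) x = 0.
    by rewrite (eq_irrelevance erefl (idx_shift (erefl (i + 1)))).
  have [x' [z [dx' ex]]] := sur (h + 1) (i + 1) (idx_shift e) x dx.
  exists x', (- z); split; last by rewrite (linN (cd_lin _)) opprK.
  by rewrite (eq_irrelevance (idx_shift _) erefl) dx' oppr0.
Qed.

Definition dgsum M N : dgmod A.
Proof.
pose C := @Cplx k (fun i => (M i * N i)%type : lmodType k)
  (fun i j h x => (cd h x.1, cd h x.2)).
unshelve refine (@DgMod k A (C _ _)
  (fun i j l h x a => (mact h x.1 a, mact h x.2 a)) _).
- by move=> i j h a [x1 x2] [y1 y2] /=; rewrite !(cd_lin _).
- by move=> i j l h h' [x1 x2] /=; rewrite !cdd.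
split=> /=.
- move=> i j l h a c [x1 x2] [y1 y2] /=.
  by rewrite (dact_linl (mactP M)) (dact_linl (mactP N)).
- move=> i j l h [x1 x2] c a b /=.
  by rewrite (dact_linr (mactP M)) (dact_linr (mactP N)).
- move=> i j l ij jl ijl h1 h2 h3 h4 [x1 x2] a b /=.
  by rewrite (dactA (mactP M) h1 h2 h3 h4) (dactA (mactP N) h1 h2 h3 h4).
- by move=> i h [x1 x2] /=; rewrite (dact1 (mactP M)) (dact1 (mactP N)).
- move=> i j l i' j' l' h hi hj hl h1 h2 [x1 x2] a /=.
  rewrite (dleib (mactP M) h hi hj hl h1 h2) (dleib (mactP N) h hi hj hl h1 h2).
  by [].
Defined.

Section Cone.
Context (M N : dgmod A) (f : dgmap M N).

Definition mcast (i j : int) (h : i = j) (x : N i) : N j := ecast j (N j) h x.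

(** [cone(f)^i = M^(i+1) (+) N^i], [d(x, y) = (- d x, f x + d y)] *)
Definition cone_d (i j : int) (h : i + 1 = j)
    (x : (M (i + 1)%R * N i)%type) : (M (j + 1)%R * N j)%type :=
  (- cd (idx_shift h) x.1, mcast h (f (i + 1) x.1) + cd h x.2).

Definition cone : dgmod A.
Proof.
pose C := @Cplx k (fun i => (M (i + 1)%R * N i)%type : lmodType k) cone_d.
unshelve refine (@DgMod k A (C _ _)
  (fun i j l h x a => (mact (idx_shift h) x.1 a, mact h x.2 a)) _).
- move=> i j h a [x1 x2] [y1 y2]; rewrite /cone_d /=.
  rewrite (cd_lin _) (cd_lin _) opprD -scalerN; congr (_, _).
  case: _ / h (idx_shift h) => h' /=.
  by rewrite (mf_lin f) scalerDr addrACA.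
- move=> i j l h h' [x1 x2]; rewrite /cone_d /=.
  rewrite (linN (cd_lin _)) cdd !oppr0 (linD (cd_lin _)) cdd addr0.
  congr (_, _); case: _ / h h' => h'; case: _ / h' => /=.
  rewrite (eq_irrelevance (idx_shift erefl) erefl).
  by rewrite (linN (@mf_lin _ _ _ _ f _)) mf_d addNr.
split=> /=.
- move=> i j l h a c [x1 x2] [y1 y2] /=.
  by rewrite (dact_linl (mactP M)) (dact_linl (mactP N)).
- move=> i j l h [x1 x2] c a b /=.
  by rewrite (dact_linr (mactP M)) (dact_linr (mactP N)).
- move=> i j l ij jl ijl h1 h2 h3 h4 [x1 x2] a b /=.
  rewrite (dactA (mactP N) h1 h2 h3 h4).
  by rewrite (dactA (mactP M) _ _ h3 (idx_shift h4)).
- by move=> i h [x1 x2] /=; rewrite (dact1 (mactP M)) (dact1 (mactP N)).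
- move=> i j l i' j' l' h hi hj hl h1 h2 [x1 x2] a; rewrite /cone_d /=.
  rewrite (dleib (mactP M) _ (idx_shift hi) hj _ (idx_shift h1) (idx_shift h2)).
  rewrite (dleib (mactP N) h hi hj hl h1 h2).
  rewrite (linN (dact_linl (mactP M) _ _)) opprD; congr (_, _).
    by rewrite ksignS scaleNr opprK.
  rewrite (linD (dact_linl (mactP N) _ _)) -addrA; congr (_ + _).
  case: _ / hl (idx_shift h) h1 h2 => hl h1 h2.
  case: _ / hi h1 => h1 /=.
  by rewrite mf_act (eq_irrelevance h1 hl).
Defined.

Definition cone_in : dgmap N cone.
Proof.
exists (fun i y => (0, y) : cone i).
- by move=> i a x y /=; congr (_, _); rewrite /= scaler0 addr0.
- move=> i j h x /=; rewrite /cone_d /=.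
  rewrite (lin0 (cd_lin _)) oppr0 (lin0 (@mf_lin _ _ _ _ f _)); congr (_, _).
  by case: _ / h => /=; rewrite add0r.
- by move=> i j l h x a /=; rewrite (lin0 (dact_linl (mactP M) _ _)).
Defined.

Definition cone_out : dgmap cone (shift M).
Proof. by exists (fun i (x : cone i) => x.1). Defined.
End Cone.
End Maps.

(** ** The derived category

    Localisation of the category of dg-modules at the quasi-isomorphisms (Gabriel
    and Zisman): morphisms are formal composites of dg-maps and of inverses of
    quasi-isomorphisms, and [deq] is equality of morphisms, the congruence
    generated by the category laws, functoriality of [dloc], and the
    requirement that [dinv s] be inverse to [dloc s].  Homotopic maps become
    equal, so this is also the localisation of the homotopy category. *)
Section Derived.
Context (k : comPzRingType) (A : dgalg k).

Inductive dhom : dgmod A -> dgmod A -> Type :=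
| dloc M N : dgmap M N -> dhom M N
| dinv M N (s : dgmap M N) : quasi_iso s -> dhom N M
| dcomp M N P : dhom N P -> dhom M N -> dhom M P.

Definition did M : dhom M M := dloc (dgid M).

Inductive deq : forall M N, dhom M N -> dhom M N -> Prop :=
| deq_refl M N (f : dhom M N) : deq f f
| deq_sym M N (f g : dhom M N) : deq f g -> deq g f
| deq_trans M N (f g h : dhom M N) : deq f g -> deq g h -> deq f h
| deq_congr M N P (f f' : dhom M N) (g g' : dhom N P) :
    deq f f' -> deq g g' -> deq (dcomp g f) (dcomp g' f')
| deq_assoc M N P Q (f : dhom M N) (g : dhom N P) (h : dhom P Q) :
    deq (dcomp h (dcomp g f)) (dcomp (dcomp h g) f)
| deq_idl M N (f : dhom M N) : deq (dcomp (did N) f) f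
| deq_idr M N (f : dhom M N) : deq (dcomp f (did M)) f
| deq_loc M N P (f : dgmap M N) (g : dgmap N P) :
    deq (dloc (dgcomp g f)) (dcomp (dloc g) (dloc f))
| deq_invl M N (s : dgmap M N) (qs : quasi_iso s) :
    deq (dcomp (dinv qs) (dloc s)) (did M)
| deq_invr M N (s : dgmap M N) (qs : quasi_iso s) :
    deq (dcomp (dloc s) (dinv qs)) (did N).

Definition is_diso M N (f : dhom M N) : Prop :=
  exists g : dhom N M, deq (dcomp g f) (did M) /\ deq (dcomp f g) (did N).

Definition disom M N : Prop := exists f : dhom M N, is_diso f.

Fixpoint dshift M N (f : dhom M N) : dhom (shift M) (shift N) :=
  match f with
  | dloc _ _ f => dloc (shiftf f)
  | dinv _ _ _ qs => dinv (shiftf_quasi_iso qs)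
  | dcomp _ _ _ g f => dcomp (dshift g) (dshift f)
  end.

(** Distinguished triangles: those isomorphic to a standard triangle
    [M -> N -> cone f -> M[1]]. *)
Definition distinguished X Y Z (u : dhom X Y) (v : dhom Y Z)
    (w : dhom Z (shift X)) : Prop :=
  exists (M N : dgmod A) (f : dgmap M N)
    (a : dhom X M) (b : dhom Y N) (c : dhom Z (cone f)),
  [/\ is_diso a, is_diso b & is_diso c] /\
  [/\ deq (dcomp b u) (dcomp (dloc f) a),
       deq (dcomp c v) (dcomp (dloc (cone_in f)) b) &
       deq (dcomp (dshift a) w) (dcomp (dloc (cone_out f)) c)].

(** Full triangulated subcategories closed under isomorphisms and direct
    summands, given by their objects. *)
Record is_thick (S : dgmod A -> Prop) : Prop := IsThick {
  thick_iso : forall M N, disom M N -> S M -> S N;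
  thick_shift : forall M, S M <-> S (shift M);
  thick_cone : forall X Y Z (u : dhom X Y) (v : dhom Y Z) (w : dhom Z (shift X)),
    distinguished u v w -> S X -> S Y -> S Z;
  thick_summand : forall M N, S (dgsum M N) -> S M }.

Definition thick (X M : dgmod A) : Prop :=
  forall S : dgmod A -> Prop, is_thick S -> S X -> S M.
End Derived.

(** ** Derived Hom and the unit of the derived adjunction *)
Section Unit.
Context (k : comPzRingType) (A S : dgalg k) (U : dgbimod A S).

(** [RHom_A(M, U)], computed by a cofibrant replacement [P] of [M]. *)
Definition rhom (M : dgmod A) (P : cofrepl M) : dgmod S := hom_bimod U P.

(** [x |-> (f |-> (-1)^(|f||x|) r(f)(x))]: the adjoint of
    [r : V -> Hom_A(P, U)]. *)
Section Ev.
Context (P : dgmod A) (V : dgmod S) (r : dgmap V (hom_bimod U P)).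

Definition ev_fun i (x : P i) p q (h : p + i = q) (v : V p) : U q :=
  ksign k (p * i) *: (r p v : hom P (bimod1 U) p) i q (eq_addC h) x.

Lemma ev_lin i (x : P i) p q (h : p + i = q) : linear (ev_fun x h).
Proof.
move=> a v w; rewrite /ev_fun (mf_lin r).
have -> : (a *: r p v + r p w : hom P (bimod1 U) p) i q (eq_addC h) x =
  a *: (r p v : hom P (bimod1 U) p) i q (eq_addC h) x
  + (r p w : hom P (bimod1 U) p) i q (eq_addC h) x by [].
by rewrite scalerDr !scalerA mulrC.
Qed.

Lemma ev_act i (x : P i) p q j p' q' (h : p + i = q) (hp : p + j = p')
    (hq : q + j = q') (h' : p' + i = q') v s :
  ev_fun x h' (mact hp v s) = mact (d := bimod2 U) hq (ev_fun x h v) s.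
Proof.
rewrite /ev_fun (mf_act r) /=.
rewrite (ha_funE _ _ _ _ _ (eq_addC h) hq).
rewrite (linZ (dact_linl (bact2P U) _ _)) scalerA; congr (_ *: _).
by rewrite -hp mulrDl ksignD -mulrA ksignK mulr1.
Qed.

Definition ev_hom i (x : P i) : hom V (bimod2 U) i :=
  @Hom k S V (bimod2 U) i (@ev_fun i x) (@ev_lin i x) (@ev_act i x).

Lemma ev_hom_lin i : linear (@ev_hom i).
Proof.
move=> a x y; apply: homP => p q h v; rewrite homDE homZE /= /ev_fun.
by rewrite (hf_lin (r p v : hom P (bimod1 U) p)) scalerDr !scalerA mulrC.
Qed.

Lemma ev_hom_d i j (h : i + 1 = j) (x : P i) : ev_hom (cd h x) = hd h (ev_hom x).
Proof.
apply: homP => p q e v /=.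
have e1 : p + i + 1 = q by lia.
have e2 : p + 1 + i = q by lia.
have e3 : i + p = p + i by lia.
have e4 : i + (p + 1) = q by lia.
have e5 : j + p = q by lia.
rewrite (hd_funE _ _ _ _ erefl e1 erefl e2) /= /ev_fun.
rewrite (mf_d r) /= (hd_funE _ _ _ _ (eq_addC erefl) e1 h (eq_addC e)).
rewrite (linZ (cd_lin _)) !scalerBr !scalerA.
have -> : ksign k i * ksign k ((p + 1) * i) = ksign k (p * i).
  by rewrite mulrDl mul1r ksignD mulrCA ksignK mulr1.
have -> : ksign k (p * j) = ksign k (p * i) * ksign k p.
  by rewrite -h mulrDr mulr1 ksignD.
by rewrite opprB addrC subrK.
Qed.

Lemma ev_hom_act i j l (h : i + j = l) (x : P i) (a : A j) :
  ev_hom (mact h x a) = mact (d := hom_bimod (bimod_swap U) V) h (ev_hom x) a.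
Proof.
apply: homP => p q e v /=.
have e1 : p + i + j = q by lia.
rewrite (ha_funE _ _ _ _ _ erefl e1) /= /ev_fun.
rewrite (hf_act (r p v : hom P (bimod1 U) p) (eq_addC erefl) h e1).
rewrite (linZ (dact_linl (bact1P U) _ _)) scalerA -ksignD (mulrC j) -mulrDr.
by congr (ksign k (_ * _) *: _); rewrite -h addrC.
Qed.

Definition ev : dgmap P (hom_bimod (bimod_swap U) V) :=
  @DgMap k A P (hom_bimod (bimod_swap U) V) ev_hom ev_hom_lin ev_hom_d
    ev_hom_act.
End Ev.
End Unit.

Arguments rhom {k A S} U {M} P.

Section DerivedUnit.
Context (k : comPzRingType) (A S : dgalg k) (U : dgbimod A S).

(** The unit [M -> RHom_S(RHom_A(M, U), U)] of the right adjoint pair of derived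
    contravariant Homs, [P] and [V] being the replacements used to compute the
    two derived functors. *)
Definition derived_unit (M : dgmod A) (P : cofrepl M) (V : cofrepl (rhom U P)) :
  dhom M (rhom (bimod_swap U) V) :=
  dcomp (dloc (ev (crmap V))) (dinv (cr_quasi_iso P)).
End DerivedUnit.

(** ** The value of the unit at [A] *)
Section Regular.
Context (k : comPzRingType) (A : dgalg k).

Lemma dgid_quasi_iso (M : dgmod A) : quasi_iso (dgid M).
Proof.
split=> h i e x dx; first by [].
by exists x, 0; split; rewrite // (lin0 (cd_lin _)) addr0.
Qed.

Lemma cd_aone (h : 0 + 1 = 1 :> int) : cd h (aone A) = 0.
Proof.
have := aleib (addr0 0) h h h (addr0 1) (add0r 1) (aone A) (aone A).
rewrite amulx1 amulx1 amul1x ksign0 scale1r => /(congr1 (+%R^~ (- cd h (aone A)))).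
by rewrite subrr addrK.
Qed.

Lemma cofibrant_dgreg : cofibrant (dgreg A).
Proof.
move=> M N p p_surj [inj sur] g.
have [x px dx] : exists2 x : M 0, p 0 x = g 0 (aone A)
    & cd (erefl (0 + 1)) x = 0.
  have dg1 : cd (erefl (0 + 1)) (g 0 (aone A)) = 0.
    by rewrite -(mf_d g) cd_aone (lin0 (@mf_lin _ _ _ _ g _)).
  have [x [z [dx ->]]] := sur (-1) 0 erefl (g 0 (aone A)) dg1.
  have [z' <-] := p_surj _ z.
  exists (x + cd erefl z').
    by rewrite (linD (@mf_lin _ _ _ _ p _)) (mf_d p).
  by rewrite (linD (cd_lin _)) dx cdd addr0.
unshelve eexists (@DgMap k A (dgreg A) M
  (fun i (a : A i) => mact (add0r i) x a) _ _ _).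
- by move=> i; apply: (dact_linr (mactP M)).
- move=> i j h a /=.
  have e1 : 0 + 1 + i = j by lia.
  rewrite (dleib (mactP M) (add0r i) erefl h h e1 (add0r j)) dx.
  by rewrite (lin0 (dact_linl (mactP M) _ _)) add0r ksign0 scale1r.
- by move=> i j l h a b /=; rewrite (dactA (mactP M) (add0r i) h h (add0r l)).
- move=> i a /=; rewrite (mf_act p) px -(mf_act g).
  by congr (g i _); apply: amul1x.
Qed.

Definition dgreg_cofrepl : cofrepl (dgreg A) :=
  CofRepl cofibrant_dgreg (dgid_quasi_iso _).
End Regular.

Section UnitRegular.
Context (k : comPzRingType) (A S : dgalg k) (U : dgbimod A S).

(** The isomorphism [U = Hom_A(A, U)], [u |-> (a |-> u a)]. *)
Definition reg_hom n (u : U n) : hom (dgreg A) (bimod1 U) n.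
Proof.
exists (fun p q h (a : A p) => bact1 (eq_addC h) u a).
- by move=> p q h; apply: (dact_linr (bact1P U)).
- move=> p q j p' q' h hp hq h' x a /=.
  by rewrite (dactA (bact1P U) (eq_addC h) hq hp (eq_addC h')).
Defined.

Definition reg_map : dgmap (bimod2 U) (rhom U (dgreg_cofrepl A)).
Proof.
exists (fun n (u : U n) => reg_hom u).
- move=> n c u u'; apply: homP => p q h a; rewrite homDE homZE /=.
  exact: (dact_linl (bact1P U)).
- move=> i j h u; apply: homP => p q e a /=.
  have e1 : p + i + 1 = q by lia.
  have e2 : p + 1 + i = q by lia.
  have e3 : i + (p + 1) = q by lia.
  rewrite (hd_funE _ _ _ _ erefl e1 erefl e2) /=.
  rewrite (dleib (bact1P U) (eq_addC erefl) h erefl e1 (eq_addC e) (eq_addC e2)).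
  by rewrite addrK.
- move=> i j l h u s; apply: homP => p q e a /=.
  have e1 : p + i + j = q by lia.
  rewrite (ha_funE _ _ _ _ _ erefl e1) /=.
  rewrite (bactC (eq_addC erefl) e1 h (eq_addC e)).
  by rewrite scalerA (mulrC j) ksignK scale1r.
Defined.

Lemma reg_map_bij n (f : rhom U (dgreg_cofrepl A) n) :
  exists! u : U n, reg_map n u = f.
Proof.
exists ((f : hom (dgreg A) (bimod1 U) n) 0 n (add0r n) (aone A)); split.
  apply: homP => p q h a /=.
  have /= <- := hf_act (f : hom (dgreg A) (bimod1 U) n) (add0r n) (add0r p)
    (eq_addC h) h (aone A) a.
  by rewrite amul1x.
by move=> u <- /=; rewrite (dact1 (bact1P U)).
Qed.

Lemma dgcomp_reg_quasi_iso V (s : dgmap V (bimod2 U)) :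
  quasi_iso s -> quasi_iso (dgcomp reg_map s).
Proof.
have inj n (u u' : U n) : reg_map n u = reg_map n u' -> u = u'.
  move=> e; have [v [_ uv]] := reg_map_bij (reg_map n u).
  by rewrite -(uv u) // -(uv u').
have sur n f : exists u : U n, reg_map n u = f.
  by have [u [eu _]] := reg_map_bij f; exists u.
case=> sinj ssur; split=> h i e x dx.
- case=> y; have [y' <-] := sur _ y; rewrite -(mf_d reg_map) => /inj sx.
  by apply: (sinj h i e x dx); exists y'.
- have [u eu] := sur _ x.
  have du : cd (erefl (i + 1)) u = 0 :> bimod2 U (i + 1).
    apply: inj; rewrite (mf_d reg_map) eu dx.
    by rewrite (lin0 (@mf_lin _ _ _ _ reg_map _)).
  have [v [z [dv ez]]] := ssur h i e u du.
  exists v, (reg_map h z); split=> //.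
  rewrite -eu [in LHS]ez (linD (@mf_lin _ _ _ _ reg_map _)).
  by rewrite -(mf_d reg_map).
Qed.

Definition reg_cofrepl (V : cofrepl (bimod2 U)) :
  cofrepl (rhom U (dgreg_cofrepl A)) :=
  CofRepl (@cr_cofibrant _ _ _ V) (dgcomp_reg_quasi_iso (cr_quasi_iso V)).

(** [A -> RHom_S(U, U)], [a |-> (v |-> (-1)^(|a||v|) v a)], where [V] is the
    replacement of [U] over [S]. *)
Definition unit_reg (V : cofrepl (bimod2 U)) :
  dhom (dgreg A) (rhom (bimod_swap U) V) :=
  derived_unit (reg_cofrepl V).
End UnitRegular.

(* Main.v *)
(** For a bimodule [U] write [F M = RHom(M, U)], a contravariant functor from
    [D(A)] to [D(S)], and [G] for its analogue in the other direction.  The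
    preimage under [F] of a thick subcategory is thick, so [M] in [thick(X)]
    implies [F M] in [thick(F X)].  Since [F U = B] and [F A = U], (a) gives [U]
    in [thick(B)]; since [G B = U] and [G U = RHom_B(U, U)], which is [A] when
    [delta_A] is an isomorphism, (b) gives (a).  Finally the modules [M] for
    which the unit [M -> G F M] is an isomorphism form a thick subcategory
    containing [U], hence containing [A] under (a). *)
From HB Require Import structures.
From mathcomp Require Import all_boot all_algebra.
From mathcomp Require Import zify ring.
From mathcomp Require Import boolp.
Require Import Defs.

Set Implicit Arguments.
Unset Strict Implicit.
Unset Printing Implicit Defensive.

Import GRing.Theory.
Local Open Scope ring_scope.

(** * Cohomology and the derived category *)

(** Morphisms of the derived category are formal composites, so RHom has to be defined on this
    syntax and to respect every generator of [deq]. This calls for a replacement that is a functor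
    on the nose: [repl] is one, and [homr] is the resulting functor. Since thick subcategories only
    concern objects, a distinguished triangle enters only through the isomorphism of its third
    vertex with the cone of a dg-map. It is then enough to compare Hom out of a cone with the cone
    of the induced map, by the explicit isomorphism [xi], and to view a shift as the cone of a map
    into an acyclic module. The same comparison turns the unit on a cone into the map of cones
    induced by the units. The replacements in the theorem are arbitrary; K-projectivity, which
    passes to cones by [xi], allows the passage between them and [repl]. *)

Lemma ksign_even (k : comPzRingType) (a b c : int) :
  a = b + (c + c) -> ksign k a = ksign k b.
Proof. by move=> ->; rewrite !ksignD ksignK mulr1. Qed.

Section Cohomology.
Context (k : comPzRingType).
Implicit Types C : cplx k.

Definition acyc C : Prop := forall h i (e : h + 1 = i) (x : C i),
  cd (erefl (i + 1)) x = 0 -> exists y : C h, x = cd e y.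

(** The lower degree is quantified existentially, so that no preferred [i - 1] has to be carried
    along with casts; [cohE] moves to any chosen [h]. *)
Definition coh C i (x y : C i) : Prop :=
  exists h (e : h + 1 = i) (z : C h), x = y + cd e z.

Lemma cd_any C i j (h : i + 1 = j) (x : C i) :
  cd (erefl (i + 1)) x = 0 -> cd h x = 0.
Proof. by case: _ / h. Qed.

Lemma cohE C i (x y : C i) h (e : h + 1 = i) :
  coh x y -> exists z, x = y + cd e z.
Proof.
case=> h' [e' [z ->]]; have E : h' = h by lia.
by move: z e'; rewrite E => z e'; exists z; rewrite (eq_irrelevance e' e).
Qed.

Lemma cohI C i (x y : C i) h (e : h + 1 = i) z : x = y + cd e z -> coh x y.
Proof. by move=> ->; exists h, e, z. Qed.

Lemma coh_refl C i (x : C i) : coh x x.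
Proof.
apply: (@cohI _ _ _ _ (i - 1) _ 0); first by lia.
by move=> e; rewrite (lin0 (cd_lin _)) addr0.
Qed.

Lemma coh_sym C i (x y : C i) : coh x y -> coh y x.
Proof.
case=> h [e [z ->]]; apply: (@cohI _ _ _ _ _ e (- z)).
by rewrite (linN (cd_lin _)) addrK.
Qed.

Lemma coh_trans C i (x y z : C i) : coh x y -> coh y z -> coh x z.
Proof.
case=> h [e [u ->]] /(cohE e) [v ->].
by apply: (@cohI _ _ _ _ _ e (v + u)); rewrite (linD (cd_lin _)) addrA.
Qed.

Lemma coh_cycle C i (x y : C i) :
  coh x y -> cd (erefl (i + 1)) y = 0 -> cd (erefl (i + 1)) x = 0.
Proof. by case=> h [e [u ->]] dy; rewrite (linD (cd_lin _)) dy cdd addr0. Qed.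

Lemma coh_subr0 C i (x y : C i) : coh (x - y) 0 <-> coh x y.
Proof.
split=> [] [h [e [u eu]]]; apply: (@cohI _ _ _ _ _ e u).
  by rewrite -(subrK y x) eu add0r addrC.
by rewrite eu add0r addrAC subrr add0r.
Qed.

Lemma acycE C : acyc C <->
  forall i (x : C i), cd (erefl (i + 1)) x = 0 -> coh x 0.
Proof.
split=> ac.
  move=> i x dx; have e : (i - 1) + 1 = i by lia.
  by have [y ->] := ac _ _ e x dx; apply: (@cohI _ _ _ _ _ e y); rewrite add0r.
move=> h i e x /ac /(cohE e) [z ->]; by exists z; rewrite add0r.
Qed.
End Cohomology.

Section DgMap.
Context (k : comPzRingType) (A : dgalg k).
Implicit Types M N P : dgmod A.

Lemma dgmapP M N (f g : dgmap M N) : (forall i x, f i x = g i x) -> f = g.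
Proof.
case: f g => [f fl fd fa] [g gl gd ga] /= e.
have {}e : f = g.
  apply: functional_extensionality_dep => p.
  by apply: functional_extensionality_dep => x; apply: e.
by subst g; congr DgMap; apply: Prop_irrelevance.
Qed.

Lemma mfD M N (f : dgmap M N) i x y : f i (x + y) = f i x + f i y.
Proof. exact: (linD (@mf_lin _ _ _ _ f _)). Qed.
Lemma mf0 M N (f : dgmap M N) i : f i 0 = 0.
Proof. exact: (lin0 (@mf_lin _ _ _ _ f _)). Qed.
Lemma mfN M N (f : dgmap M N) i x : f i (- x) = - f i x.
Proof. exact: (linN (@mf_lin _ _ _ _ f _)). Qed.
Lemma mfB M N (f : dgmap M N) i x y : f i (x - y) = f i x - f i y.
Proof. by rewrite mfD mfN. Qed.
Lemma mfZ M N (f : dgmap M N) i a x : f i (a *: x) = a *: f i x.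
Proof. exact: (linZ (@mf_lin _ _ _ _ f _)). Qed.

Lemma coh_mf M N (f : dgmap M N) i (x y : M i) : coh x y -> coh (f i x) (f i y).
Proof.
by case=> h [e [z ->]]; apply: (@cohI _ _ _ _ _ _ e (f h z)); rewrite mfD mf_d.
Qed.

Lemma cycle_mf M N (f : dgmap M N) i (x : M i) :
  cd (erefl (i + 1)) x = 0 -> cd (erefl (i + 1)) (f i x) = 0.
Proof. by move=> dx; rewrite -mf_d dx mf0. Qed.

Lemma quasi_isoE M N (f : dgmap M N) : quasi_iso f <->
  (forall i (x : M i), cd (erefl (i + 1)) x = 0 -> coh (f i x) 0 -> coh x 0) /\
  (forall i (y : N i), cd (erefl (i + 1)) y = 0 ->
     exists2 x : M i, cd (erefl (i + 1)) x = 0 & coh y (f i x)).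
Proof.
split=> [] [inj sur]; split.
- move=> i x dx; have e : (i - 1) + 1 = i by lia.
  case/(cohE e) => z; rewrite add0r => fx.
  have [|x' ->] := inj _ _ e x dx; first by exists z.
  by apply: (@cohI _ _ _ _ _ _ e x'); rewrite add0r.
- move=> i y dy; have e : (i - 1) + 1 = i by lia.
  have [x [z [dx ->]]] := sur _ _ e y dy.
  by exists x; last exact: (@cohI _ _ _ _ _ _ e z).
- move=> h i e x dx [y fx]; have /(inj i x dx) : coh (f i x) 0.
    by apply: (@cohI _ _ _ _ _ _ e y); rewrite add0r.
  by case/(cohE e) => z ->; exists z; rewrite add0r.
- move=> h i e y dy; have [x dx /(cohE e) [z ez]] := sur i y dy.
  by exists x, z.
Qed.

Lemma acyc_qi M N (f : dgmap M N) : acyc M -> acyc N -> quasi_iso f.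
Proof.
move=> /acycE aM /acycE aN; apply/quasi_isoE; split=> [i x dx _|i y dy].
  exact: aM.
exists 0; first by rewrite (lin0 (cd_lin _)).
by rewrite mf0; apply: aN.
Qed.

Lemma bij_qi M N (f : dgmap M N) : (forall i x, f i x = 0 -> x = 0) ->
  (forall i y, exists x, f i x = y) -> quasi_iso f.
Proof.
move=> inj sur; apply/quasi_isoE; split=> [i x dx|i y dy].
  case=> h [e [z ez]]; have [w wz] := sur h z.
  have -> : x = cd e w; last by apply: (@cohI _ _ _ _ _ _ e w); rewrite add0r.
  apply/eqP; rewrite -subr_eq0; apply/eqP/inj.
  by rewrite mfB ez add0r -wz mf_d subrr.
have [x fx] := sur i y; exists x; last by rewrite fx; apply: coh_refl.
by apply: inj; rewrite mf_d fx.
Qed.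
End DgMap.

(** * Isomorphisms in the localisation and their effect on cohomology *)

Section DerivedBasics.
Context (k : comPzRingType) (A : dgalg k).
Implicit Types M N P : dgmod A.

Lemma deq_comp2l M N P (g : dhom N P) (f f' : dhom M N) :
  deq f f' -> deq (dcomp g f) (dcomp g f').
Proof. by move=> e; apply: deq_congr => //; apply: deq_refl. Qed.

Lemma deq_comp2r M N P (g g' : dhom N P) (f : dhom M N) :
  deq g g' -> deq (dcomp g f) (dcomp g' f).
Proof. by move=> e; apply: deq_congr => //; apply: deq_refl. Qed.

Lemma dcompKl M N P (g : dhom N P) (h : dhom P N) (f : dhom M N) :
  deq (dcomp h g) (did N) -> deq (dcomp h (dcomp g f)) f.
Proof.
move=> e; apply: deq_trans (deq_assoc _ _ _) _.
by apply: deq_trans (deq_comp2r _ e) _; apply: deq_idl.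
Qed.

Lemma dcompKr M N P (g : dhom N P) (h : dhom M N) (f : dhom N M) :
  deq (dcomp h f) (did N) -> deq (dcomp (dcomp g h) f) g.
Proof.
move=> e; apply: deq_trans (deq_sym (deq_assoc _ _ _)) _.
by apply: deq_trans (deq_comp2l _ e) _; apply: deq_idr.
Qed.

Lemma diso_id M : is_diso (did M).
Proof. by exists (did M); split; apply: deq_idl. Qed.

Lemma diso_deq M N (f g : dhom M N) : deq f g -> is_diso f -> is_diso g.
Proof.
move=> e [h [hf fh]]; exists h; split.
  by apply: deq_trans (deq_comp2l _ (deq_sym e)) hf.
by apply: deq_trans (deq_comp2r _ (deq_sym e)) fh.
Qed.

Lemma diso_comp M N P (g : dhom N P) (f : dhom M N) :
  is_diso f -> is_diso g -> is_diso (dcomp g f).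
Proof.
move=> [f' [f'f ff']] [g' [g'g gg']]; exists (dcomp f' g'); split.
  apply: deq_trans (deq_sym (deq_assoc _ _ _)) _.
  by apply: deq_trans f'f; apply: deq_comp2l; apply: dcompKl.
apply: deq_trans (deq_sym (deq_assoc _ _ _)) _.
by apply: deq_trans gg'; apply: deq_comp2l; apply: dcompKl.
Qed.

Lemma diso_loc M N (s : dgmap M N) : quasi_iso s -> is_diso (dloc s).
Proof.
by move=> q; exists (dinv q); split; [apply: deq_invl|apply: deq_invr].
Qed.

Lemma diso_dinv M N (s : dgmap M N) (q : quasi_iso s) : is_diso (dinv q).
Proof. by exists (dloc s); split; [apply: deq_invr|apply: deq_invl]. Qed.

Lemma diso_cancel_r M N P (g : dhom N P) (f : dhom M N) :
  is_diso f -> is_diso (dcomp g f) -> is_diso g.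
Proof.
move=> [f' [f'f ff']] gf; have df' : is_diso f' by exists f.
by apply: diso_deq (diso_comp df' gf); apply: dcompKr.
Qed.

Lemma diso_cancel_l M N P (g : dhom N P) (f : dhom M N) :
  is_diso g -> is_diso (dcomp g f) -> is_diso f.
Proof.
move=> [g' [g'g gg']] gf; have dg' : is_diso g' by exists g.
by apply: diso_deq (diso_comp gf dg'); apply: dcompKl.
Qed.

Lemma disom_sym M N : disom M N -> disom N M.
Proof. by case=> f [g [gf fg]]; exists g; exists f. Qed.
Lemma disom_trans M N P : disom M N -> disom N P -> disom M P.
Proof. by case=> f df [g dg]; exists (dcomp g f); apply: diso_comp. Qed.
Lemma qi_disom M N (s : dgmap M N) : quasi_iso s -> disom M N.
Proof. by move=> q; exists (dloc s); apply: diso_loc. Qed.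

(* [dhcoh f x y] says that [y] represents the image under [H^i(f)] of the
   class of [x]. *)
Fixpoint dhcoh M N (f : dhom M N) {struct f} : forall i, M i -> N i -> Prop :=
  match f in dhom M N return forall i, M i -> N i -> Prop with
  | dloc _ _ f => fun i x y =>
      cd (erefl (i + 1)) x = 0 /\ coh y (f i x)
  | dinv _ _ s _ => fun i x y =>
      cd (erefl (i + 1)) y = 0 /\ coh x (s i y)
  | dcomp _ _ _ g f => fun i x z =>
      exists y, dhcoh f x y /\ dhcoh g y z
  end.

Lemma dhcoh_cycle M N (f : dhom M N) i (x : M i) (y : N i) : dhcoh f x y ->
  cd (erefl (i + 1)) x = 0 /\ cd (erefl (i + 1)) y = 0.
Proof.
elim: f x y => {M N} [M N f|M N s _|M N P g IHg f IHf] x y /=.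
- by case=> dx c; split=> //; apply: coh_cycle c _; apply: cycle_mf.
- by case=> dy c; split=> //; apply: coh_cycle c _; apply: cycle_mf.
- by case=> z [/IHf [? _] /IHg [_ ?]].
Qed.

Lemma dhcoh_coh M N (f : dhom M N) i (x x' : M i) (y y' : N i) :
  coh x x' -> coh y y' -> dhcoh f x y -> dhcoh f x' y'.
Proof.
elim: f x x' y y' => {M N} [M N f|M N s _|M N P g IHg f IHf] x x' y y' cx cy /=.
- case=> dx c; split; first exact: coh_cycle (coh_sym cx) _.
  by apply: coh_trans (coh_sym cy) (coh_trans c _); apply: coh_mf.
- case=> dx c; split; first exact: coh_cycle (coh_sym cy) _.
  by apply: coh_trans (coh_sym cx) (coh_trans c _); apply: coh_mf.
- case=> z [h1 h2]; exists z; split.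
    exact: (IHf x x' z z cx (coh_refl _)).
  exact: (IHg z z y y' (coh_refl _) cy).
Qed.

(** As [deq] is generated inductively, an equation in the derived category can only be exploited
    through an invariant of formal composites; cohomology is one. *)
Lemma dhcoh_deq M N (f g : dhom M N) : deq f g ->
  forall i (x : M i) (y : N i), dhcoh f x y <-> dhcoh g x y.
Proof.
elim=> {M N f g}.
- by [].
- by move=> M N f g _ IH i x y; split=> /IH.
- by move=> M N f g h _ IH1 _ IH2 i x y; split=> [/IH1/IH2|/IH2/IH1].
- move=> M N P f f' g g' _ IHf _ IHg i x y /=.
  by split=> [] [z [/IHf ? /IHg ?]]; exists z.
- move=> M N P Q f g h i x y /=; split.
    by move=> [z [[w [? ?]] ?]]; exists w; split=> //; exists z.
  by move=> [z [? [w [? ?]]]]; exists w; split=> //; exists z.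
- move=> M N f i x y /=; split.
    case=> z [h [dz c]]; apply: dhcoh_coh h; [exact: coh_refl|].
    exact: coh_sym.
  move=> h; exists y; split=> //; have [_ dy] := dhcoh_cycle h.
  by split=> //; apply: coh_refl.
- move=> M N f i x y /=; split.
    case=> z [[dx c] h]; exact: dhcoh_coh c (coh_refl _) h.
  move=> h; exists x; split=> //; have [dx _] := dhcoh_cycle h.
  by split=> //; apply: coh_refl.
- move=> M N P f g i x y /=; split.
    case=> dx c; exists (f i x); split; first by split=> //; apply: coh_refl.
    by split=> //; apply: cycle_mf.
  case=> z [[dx c] [dz c']]; split=> //; apply: coh_trans c' _.
  exact: coh_mf.
- move=> M N s qs i x y /=; have [inj sur] := (quasi_isoE s).1 qs; split.
    case=> z [[dx c] [dy c']]; split=> //; apply/coh_subr0/inj.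
      by rewrite (linB (cd_lin _)) dx dy subrr.
    by rewrite mfB; apply/coh_subr0; apply: coh_trans (coh_sym c') c.
  case=> dx c; have dy := coh_cycle c dx; exists (s i x); split.
    by split=> //; apply: coh_refl.
  by split=> //; apply: coh_mf; apply: coh_sym.
- move=> M N s qs i x y /=; have [inj sur] := (quasi_isoE s).1 qs; split.
    case=> z [[dz c] [_ c']]; split.
      by apply: coh_cycle c _; apply: cycle_mf.
    exact: coh_trans c' (coh_sym c).
  case=> dx c; have [z dz cz] := sur i x dx; exists z; split=> //.
  by split=> //; apply: coh_trans c cz.
Qed.

(** Saturation: no dg-maps other than quasi-isomorphisms become invertible. The cancellation laws
    for quasi-isomorphisms below follow from those for isomorphisms. *)
Lemma diso_qi M N (f : dgmap M N) : is_diso (dloc f) -> quasi_iso f.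
Proof.
case=> g [/dhcoh_deq gf /dhcoh_deq fg]; apply/quasi_isoE; split.
  move=> i x dx c; have /gf/= [z [[_ c1] h]] : dhcoh (did M) x x.
    by split=> //; apply: coh_refl.
  (* As [f x] is a coboundary, [g f] also relates 0 to [x]; being the identity, it forces the class
     of [x] to vanish. *)
  have z0 : dhcoh (dcomp g (dloc f)) (0 : M i) x.
    exists z; split=> //; split; first by rewrite (lin0 (cd_lin _)).
    by rewrite mf0; apply: coh_trans c.
  by have /gf [_] := z0.
move=> i y dy; have /fg/= [x [_ [dx c]]] : dhcoh (did N) y y.
  by split=> //; apply: coh_refl.
by exists x.
Qed.

Lemma qi_comp M N P (g : dgmap N P) (f : dgmap M N) :
  quasi_iso f -> quasi_iso g -> quasi_iso (dgcomp g f).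
Proof.
move=> /diso_loc qf /diso_loc qg; apply: diso_qi.
by apply: diso_deq (deq_sym (deq_loc _ _)) _; apply: diso_comp.
Qed.

Lemma qi_cancel_r M N P (g : dgmap N P) (f : dgmap M N) :
  quasi_iso f -> quasi_iso (dgcomp g f) -> quasi_iso g.
Proof.
move=> /diso_loc qf /diso_loc /(diso_deq (deq_loc _ _)) qg.
exact/diso_qi/diso_cancel_r/qg.
Qed.

Lemma qi_cancel_l M N P (g : dgmap N P) (f : dgmap M N) :
  quasi_iso g -> quasi_iso (dgcomp g f) -> quasi_iso f.
Proof.
move=> /diso_loc qf /diso_loc /(diso_deq (deq_loc _ _)) qg.
exact/diso_qi/diso_cancel_l/qg.
Qed.

Lemma acyc_transfer M N (f : dgmap M N) : quasi_iso f -> acyc M <-> acyc N.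
Proof.
case/quasi_isoE => inj sur; split=> /acycE a; apply/acycE => i x dx.
  have [y dy c] := sur i x dx; apply: coh_trans c _.
  by rewrite -(mf0 f); apply: coh_mf; apply: a.
by apply: inj => //; apply: a; apply: cycle_mf.
Qed.
End DerivedBasics.

(** * A functorial cofibrant replacement *)

Section Replacement.
Context (k : comPzRingType) (A : dgalg k).

Section Raw.
Context (M : dgmod A).

(* [repl M] is the initial dg-module over [M] with a chosen solution [rawf m z] of
   every lifting problem: if [z] is a cycle lying over [d m], then [rawf m z] lies
   over [m] and has differential [z].  Initiality yields cofibrancy, and no
   transfinite construction is needed.  For other pairs [rawf m z] is a free
   generator over [m]. *)
Inductive raw : int -> Type :=
| raw0 i : raw i
| rawD i : raw i -> raw i -> raw i
| rawZ i : k -> raw i -> raw i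
| rawd i j : i + 1 = j -> raw i -> raw j
| rawa i j l : i + j = l -> raw i -> A j -> raw l
| rawf i : M i -> raw (i + 1) -> raw i.

Fixpoint rval i (e : raw i) : M i :=
  match e in raw i return M i with
  | raw0 _ => 0
  | rawD _ x y => rval x + rval y
  | rawZ _ c x => c *: rval x
  | rawd _ _ h x => cd h (rval x)
  | rawa _ _ _ h x a => mact h (rval x) a
  | rawf _ m _ => m
  end.

Inductive req : forall i, raw i -> raw i -> Prop :=
| req_refl i (x : raw i) : req x x
| req_sym i (x y : raw i) : req x y -> req y x
| req_trans i (x y z : raw i) : req x y -> req y z -> req x z
| req_D i (x x' y y' : raw i) :
    req x x' -> req y y' -> req (rawD x y) (rawD x' y')
| req_Z i c (x x' : raw i) : req x x' -> req (rawZ c x) (rawZ c x')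
| req_d i j (h : i + 1 = j) x x' : req x x' -> req (rawd h x) (rawd h x')
| req_a i j l (h : i + j = l) x x' a :
    req x x' -> req (rawa h x a) (rawa h x' a)
| req_DA i (x y z : raw i) : req (rawD x (rawD y z)) (rawD (rawD x y) z)
| req_DC i (x y : raw i) : req (rawD x y) (rawD y x)
| req_0D i (x : raw i) : req (rawD (raw0 i) x) x
| req_ND i (x : raw i) : req (rawD (rawZ (- 1) x) x) (raw0 i)
| req_ZA i a b (x : raw i) : req (rawZ a (rawZ b x)) (rawZ (a * b) x)
| req_1Z i (x : raw i) : req (rawZ 1 x) x
| req_ZDr i a (x y : raw i) :
    req (rawZ a (rawD x y)) (rawD (rawZ a x) (rawZ a y))
| req_ZDl i a b (x : raw i) :
    req (rawZ (a + b) x) (rawD (rawZ a x) (rawZ b x))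
| req_dlin i j (h : i + 1 = j) a x y :
    req (rawd h (rawD (rawZ a x) y)) (rawD (rawZ a (rawd h x)) (rawd h y))
| req_dd i j l (h : i + 1 = j) (h' : j + 1 = l) x :
    req (rawd h' (rawd h x)) (raw0 l)
| req_linl i j l (h : i + j = l) c x y a :
    req (rawa h (rawD (rawZ c x) y) a) (rawD (rawZ c (rawa h x a)) (rawa h y a))
| req_linr i j l (h : i + j = l) c x a b :
    req (rawa h x (c *: a + b)) (rawD (rawZ c (rawa h x a)) (rawa h x b))
| req_aA i j l ij jl ijl (h1 : i + j = ij) (h2 : ij + l = ijl)
    (h3 : j + l = jl) (h4 : i + jl = ijl) x a b :
    req (rawa h2 (rawa h1 x a) b) (rawa h4 x (amul h3 a b))
| req_a1 i (h : i + 0 = i) x : req (rawa h x (aone A)) x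
| req_leib i j l i' j' l' (h : i + j = l) (hi : i + 1 = i')
    (hj : j + 1 = j') (hl : l + 1 = l') (h1 : i' + j = l') (h2 : i + j' = l')
    x a :
    req (rawd hl (rawa h x a))
        (rawD (rawa h1 (rawd hi x) a) (rawZ (ksign k i) (rawa h2 x (cd hj a))))
| req_fill i m (z : raw (i + 1)) :
    req (rawd (erefl (i + 1 + 1)) z) (raw0 _) ->
    rval z = cd (erefl (i + 1)) m ->
    req (rawd (erefl (i + 1)) (rawf m z)) z.

Lemma rval_req i (x y : raw i) : req x y -> rval x = rval y.
Proof.
elim=> {i x y} //=; try by move=> *; congruence.
- by move=> *; rewrite addrA.
- by move=> *; rewrite addrC.
- by move=> *; rewrite add0r.
- by move=> *; rewrite scaleN1r addNr.
- by move=> *; rewrite scalerA.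
- by move=> *; rewrite scale1r.
- by move=> *; rewrite scalerDr.
- by move=> *; rewrite scalerDl.
- by move=> *; rewrite (cd_lin _).
- by move=> *; rewrite cdd.
- by move=> *; rewrite (dact_linl (mactP M)).
- by move=> *; rewrite (dact_linr (mactP M)).
- by move=> *; apply: (dactA (mactP M)).
- by move=> *; apply: (dact1 (mactP M)).
- by move=> *; apply: (dleib (mactP M)).
Qed.

(** The quotient of [raw] by [req]: an element is a class viewed as a predicate, and extensionality
    identifies the classes of related terms. *)
Record qm i := QM { qc : raw i -> Prop; qcP : exists x, qc = req x }.

Definition cls i (x : raw i) : qm i := QM (ex_intro _ x erefl).
Definition repr i (c : qm i) : raw i := projT1 (cid (qcP c)).

Lemma reprK i (c : qm i) : cls (repr c) = c.
Proof.
rewrite /repr; case: cid => x /=; case: c => C cP /= e; subst C.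
by rewrite /cls; congr QM; apply: Prop_irrelevance.
Qed.

Lemma clsE i (x y : raw i) : cls x = cls y <-> req x y.
Proof.
split=> [[e]|e].
  by rewrite e; apply: req_refl.
have {}e : req x = req y.
  apply: functional_extensionality_dep => z.
  apply: propositional_extensionality.
  by split; [apply: req_trans; apply: req_sym|apply: req_trans].
rewrite /cls; move: (ex_intro _ x _) (ex_intro _ y _) => /=.
by case: _ / e => p q; congr QM; apply: Prop_irrelevance.
Qed.

Lemma req_repr i (x : raw i) : req (repr (cls x)) x.
Proof. by apply/clsE; rewrite reprK. Qed.

HB.instance Definition _ i := gen_eqMixin (qm i).
HB.instance Definition _ i := gen_choiceMixin (qm i).

Definition qm0 i := cls (raw0 i).
Definition qmD i (c d : qm i) := cls (rawD (repr c) (repr d)).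
Definition qmZ i a (c : qm i) := cls (rawZ a (repr c)).

Lemma qmDE i (x y : raw i) : qmD (cls x) (cls y) = cls (rawD x y).
Proof. by apply/clsE; apply: req_D; apply: req_repr. Qed.
Lemma qmZE i a (x : raw i) : qmZ a (cls x) = cls (rawZ a x).
Proof. by apply/clsE; apply: req_Z; apply: req_repr. Qed.

Lemma qmDA i : associative (@qmD i).
Proof.
move=> x y z; rewrite -(reprK x) -(reprK y) -(reprK z) !qmDE.
by apply/clsE; apply: req_DA.
Qed.
Lemma qmDC i : commutative (@qmD i).
Proof.
by move=> x y; rewrite -(reprK x) -(reprK y) !qmDE; apply/clsE; apply: req_DC.
Qed.
Lemma qm0D i : left_id (qm0 i) (@qmD i).
Proof. by move=> x; rewrite -(reprK x) qmDE; apply/clsE; apply: req_0D. Qed.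
Lemma qmND i : left_inverse (qm0 i) (qmZ (- 1)) (@qmD i).
Proof.
by move=> x; rewrite -(reprK x) qmZE qmDE; apply/clsE; apply: req_ND.
Qed.

HB.instance Definition _ i :=
  GRing.isZmodule.Build (qm i) (@qmDA i) (@qmDC i) (@qm0D i) (@qmND i).

Lemma qmZA i a b (x : qm i) : qmZ a (qmZ b x) = qmZ (a * b) x.
Proof. by rewrite -(reprK x) !qmZE; apply/clsE; apply: req_ZA. Qed.
Lemma qm1Z i : left_id 1 (@qmZ i).
Proof. by move=> x; rewrite -(reprK x) qmZE; apply/clsE; apply: req_1Z. Qed.
Lemma qmZDr i : right_distributive (@qmZ i) (@qmD i).
Proof.
move=> a x y; rewrite -(reprK x) -(reprK y) !(qmZE, qmDE).
by apply/clsE; apply: req_ZDr.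
Qed.
Lemma qmZDl i (x : qm i) a b : qmZ (a + b) x = qmD (qmZ a x) (qmZ b x).
Proof. by rewrite -(reprK x) !(qmZE, qmDE); apply/clsE; apply: req_ZDl. Qed.

HB.instance Definition _ i :=
  GRing.Zmodule_isLmodule.Build k (qm i) (@qmZA i) (@qm1Z i) (@qmZDr i)
    (@qmZDl i).

Lemma clsD i (x y : raw i) : cls (rawD x y) = cls x + cls y.
Proof. by rewrite -qmDE. Qed.
Lemma clsZ i a (x : raw i) : cls (rawZ a x) = a *: cls x.
Proof. by rewrite -qmZE. Qed.
Lemma cls0 i : cls (raw0 i) = 0.
Proof. by []. Qed.

Definition qmd i j (h : i + 1 = j) (c : qm i) : qm j := cls (rawd h (repr c)).
Definition qma i j l (h : i + j = l) (c : qm i) (a : A j) : qm l :=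
  cls (rawa h (repr c) a).

Lemma qmdE i j (h : i + 1 = j) x : qmd h (cls x) = cls (rawd h x).
Proof. by apply/clsE; apply: req_d; apply: req_repr. Qed.
Lemma qmaE i j l (h : i + j = l) x a : qma h (cls x) a = cls (rawa h x a).
Proof. by apply/clsE; apply: req_a; apply: req_repr. Qed.

Lemma qmd_lin i j (h : i + 1 = j) : linear (qmd h).
Proof.
move=> a x y; rewrite -(reprK x) -(reprK y) -clsZ -clsD !qmdE -clsZ -clsD.
by apply/clsE; apply: req_dlin.
Qed.
Lemma qmdd i j l (h : i + 1 = j) (h' : j + 1 = l) x : qmd h' (qmd h x) = 0.
Proof. by rewrite -(reprK x) !qmdE; apply/clsE; apply: req_dd. Qed.

Definition replcx : cplx k := Cplx qmd_lin qmdd.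

Lemma qmaP : @is_dgact k A replcx qma.
Proof.
split=> /=.
- move=> i j l h a c x y; rewrite -(reprK x) -(reprK y) -clsZ -clsD !qmaE.
  by rewrite -clsZ -clsD; apply/clsE; apply: req_linl.
- move=> i j l h x c a b; rewrite -(reprK x) !qmaE -clsZ -clsD.
  by apply/clsE; apply: req_linr.
- move=> i j l ij jl ijl h1 h2 h3 h4 x a b; rewrite -(reprK x) !qmaE.
  by apply/clsE; apply: req_aA.
- by move=> i h x; rewrite -(reprK x) qmaE; apply/clsE; apply: req_a1.
- move=> i j l i' j' l' h hi hj hl h1 h2 x a; rewrite -(reprK x).
  rewrite !(qmdE, qmaE) -clsZ -clsD.
  by apply/clsE; apply: req_leib.
Qed.

Definition repl : dgmod A := DgMod qmaP.

Definition eps : dgmap repl M.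
Proof.
exists (fun i (c : repl i) => rval (repr c)).
- move=> i a x y; rewrite -(reprK x) -(reprK y) -clsZ -clsD.
  by rewrite !(rval_req (req_repr _)).
- move=> i j h x; rewrite -(reprK x) /= qmdE.
  by rewrite !(rval_req (req_repr _)).
- move=> i j l h x a; rewrite -(reprK x) /= qmaE.
  by rewrite !(rval_req (req_repr _)).
Defined.

Lemma eps_cls i (x : raw i) : eps i (cls x) = rval x.
Proof. exact: rval_req (req_repr _). Qed.

Lemma eps_surj i (m : M i) : exists x, eps i x = m.
Proof. by exists (cls (rawf m (raw0 _))); rewrite eps_cls. Qed.

(** Both halves are instances of [req_fill]: a cycle lying over [d y] bounds the generator that
    fills it over [y], and filling 0 over a cycle gives a cycle lying over it. *)
Lemma eps_qi : quasi_iso eps.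
Proof.
split=> h i e x dx.
  case=> y; case: _ / e x dx => x dx; rewrite -(reprK x) eps_cls => ex.
  exists (cls (rawf y (repr x))) => /=; rewrite qmdE; apply/clsE/req_sym.
  by apply: req_fill => //; apply/clsE; rewrite -qmdE reprK.
exists (cls (rawf x (raw0 _))), 0; split; last first.
  by rewrite eps_cls (lin0 (cd_lin _)) addr0.
rewrite /= qmdE; apply/clsE/req_fill => //=; apply/clsE; rewrite -qmdE cls0.
exact: lin0 (@qmd_lin _ _ _).
Qed.

Section Lift.
Context (X Y : dgmod A) (p : dgmap X Y).
Hypotheses (p_surj : forall i y, exists x, p i x = y) (p_qi : quasi_iso p).
Context (g : dgmap repl Y).

(** A trivial fibration solves the filling problems that define [repl M]. Injectivity on cohomology
    gives a primitive of [w]; its error over [y] is a cycle, corrected by a cycle upstairs and a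
    lifted boundary. *)
Lemma lift_fill i (y : Y i) (w : X (i + 1)) :
  cd (erefl (i + 1 + 1)) w = 0 -> p _ w = cd (erefl (i + 1)) y ->
  exists x, p i x = y /\ cd (erefl (i + 1)) x = w.
Proof.
case: p_qi => inj sur dw pw.
have [|x0 ex0] := inj i (i + 1) erefl w dw; first by exists y.
have dy : cd (erefl (i + 1)) (y - p i x0) = 0.
  by rewrite (linB (cd_lin _)) -mf_d -ex0 pw subrr.
have h : (i - 1) + 1 = i by lia.
have [x1 [z [dx1 ez]]] := sur _ _ h _ dy; have [z' pz'] := p_surj z.
exists (x0 + (x1 + cd h z')); split.
  by rewrite !mfD mf_d pz' -ez addrC subrK.
by rewrite !(linD (cd_lin _)) dx1 cdd !addr0.
Qed.

(** Outside genuine filling problems any preimage of [y] is taken, so that [p_fill] holds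
    unconditionally. *)
Definition fill i (y : Y i) (w : X (i + 1)) : X i :=
  match pselect (exists x, p i x = y /\ cd (erefl (i + 1)) x = w) with
  | left h => projT1 (cid h)
  | right _ => projT1 (cid (p_surj y))
  end.

Lemma p_fill i (y : Y i) w : p i (fill y w) = y.
Proof. by rewrite /fill; case: pselect => h; case: cid => x []. Qed.

Lemma d_fill i (y : Y i) (w : X (i + 1)) :
  cd (erefl (i + 1 + 1)) w = 0 -> p _ w = cd (erefl (i + 1)) y ->
  cd (erefl (i + 1)) (fill y w) = w.
Proof.
move=> dw pw; rewrite /fill; case: pselect => [h|[]]; last exact: lift_fill.
by case: cid => x [].
Qed.

Fixpoint rlift i (e : raw i) : X i :=
  match e in raw i return X i with
  | raw0 _ => 0
  | rawD _ x y => rlift x + rlift y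
  | rawZ _ c x => c *: rlift x
  | rawd _ _ h x => cd h (rlift x)
  | rawa _ _ _ h x a => mact h (rlift x) a
  | rawf _ m z => fill (g _ (cls (rawf m z))) (rlift z)
  end.

(** This holds on raw terms, before [rlift] is known to respect [req]; the [req_fill] case of that
    compatibility relies on it. *)
Lemma p_rlift i (e : raw i) : p i (rlift e) = g i (cls e).
Proof.
elim: e => {i} /=.
- by move=> i; rewrite cls0 !mf0.
- by move=> i x IHx y IHy; rewrite clsD !mfD IHx IHy.
- by move=> i c x IH; rewrite clsZ !mfZ IH.
- by move=> i j h x IH; rewrite -qmdE mf_d IH -mf_d.
- by move=> i j l h x IH a; rewrite -qmaE mf_act IH -mf_act.
- by move=> i m z IH; rewrite p_fill.
Qed.

Lemma rlift_req i (x y : raw i) : req x y -> rlift x = rlift y.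
Proof.
elim=> {i x y} //=; try by move=> *; congruence.
- by move=> *; rewrite addrA.
- by move=> *; rewrite addrC.
- by move=> *; rewrite add0r.
- by move=> *; rewrite scaleN1r addNr.
- by move=> *; rewrite scalerA.
- by move=> *; rewrite scale1r.
- by move=> *; rewrite scalerDr.
- by move=> *; rewrite scalerDl.
- by move=> *; rewrite (cd_lin _).
- by move=> *; rewrite cdd.
- by move=> *; rewrite (dact_linl (mactP X)).
- by move=> *; rewrite (dact_linr (mactP X)).
- by move=> *; apply: (dactA (mactP X)).
- by move=> *; apply: (dact1 (mactP X)).
- by move=> *; apply: (dleib (mactP X)).
- move=> i m z rz dz ez; rewrite d_fill //.
  rewrite p_rlift -mf_d /= qmdE; congr (g _ _).
  by apply/esym/clsE/req_fill.
Qed.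

Definition replift : dgmap repl X.
Proof.
exists (fun i (c : repl i) => rlift (repr c)).
- move=> i a x y; rewrite -(reprK x) -(reprK y) -clsZ -clsD.
  by rewrite !(rlift_req (req_repr _)).
- move=> i j h x; rewrite -(reprK x) /= qmdE.
  by rewrite !(rlift_req (req_repr _)).
- move=> i j l h x a; rewrite -(reprK x) /= qmaE.
  by rewrite !(rlift_req (req_repr _)).
Defined.
End Lift.

Lemma repl_cofibrant : cofibrant repl.
Proof.
move=> X Y p ps pq g; exists (replift ps pq g) => i x.
by rewrite /= p_rlift reprK.
Qed.
End Raw.

Fixpoint rmap M N (f : dgmap M N) i (e : raw M i) : raw N i :=
  match e in raw _ i return raw N i with
  | raw0 i => raw0 N i
  | rawD _ x y => rawD (rmap f x) (rmap f y)
  | rawZ _ c x => rawZ c (rmap f x)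
  | rawd _ _ h x => rawd h (rmap f x)
  | rawa _ _ _ h x a => rawa h (rmap f x) a
  | rawf _ m z => rawf (f _ m) (rmap f z)
  end.

Lemma rval_rmap M N (f : dgmap M N) i (e : raw M i) :
  rval (rmap f e) = f i (rval e).
Proof.
elim: e => {i} //=.
- by move=> i; rewrite mf0.
- by move=> i x -> y ->; rewrite mfD.
- by move=> i c x ->; rewrite mfZ.
- by move=> i j h x ->; rewrite mf_d.
- by move=> i j l h x -> a; rewrite mf_act.
Qed.

Lemma rmap_req M N (f : dgmap M N) i (x y : raw M i) :
  req x y -> req (rmap f x) (rmap f y).
Proof.
elim=> {i x y} /=; try by [move=> *; constructor|move=> *; econstructor; eauto].
by move=> i m z _ rz ez; apply: req_fill => //; rewrite rval_rmap ez mf_d.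
Qed.

Lemma rmap_repr M N (f : dgmap M N) i (x : raw M i) :
  cls (rmap f (repr (cls x))) = cls (rmap f x).
Proof. exact/clsE/rmap_req/req_repr. Qed.

(** Acting on terms makes [replf] strictly functorial, whereas lifts chosen by cofibrancy would
    compose only up to homotopy. *)
Definition replf M N (f : dgmap M N) : dgmap (repl M) (repl N).
Proof.
exists (fun i (c : repl M i) => cls (rmap f (repr c)) : repl N i).
- move=> i a x y; rewrite -(reprK x) -(reprK y) -clsZ -clsD !rmap_repr /=.
  by rewrite clsD clsZ.
- by move=> i j h x; rewrite -(reprK x) /= qmdE !rmap_repr qmdE.
- by move=> i j l h x a; rewrite -(reprK x) /= qmaE !rmap_repr qmaE.
Defined.

Lemma replf_cls M N (f : dgmap M N) i (x : raw M i) :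
  replf f i (cls x) = cls (rmap f x).
Proof. exact: rmap_repr. Qed.

Lemma eps_nat M N (f : dgmap M N) :
  dgcomp (eps N) (replf f) = dgcomp f (eps M).
Proof.
apply: dgmapP => i x; rewrite -[LHS]/(eps N i (replf f i x)).
by rewrite -[RHS]/(f i (eps M i x)) -(reprK x) replf_cls !eps_cls rval_rmap.
Qed.

Lemma replf_id M : replf (dgid M) = dgid (repl M).
Proof.
apply: dgmapP => i x; rewrite -(reprK x) replf_cls /=; congr cls.
by elim: (repr x) => {i x} //= *; congruence.
Qed.

Lemma replf_comp M N P (g : dgmap N P) (f : dgmap M N) :
  replf (dgcomp g f) = dgcomp (replf g) (replf f).
Proof.
apply: dgmapP => i x; rewrite -(reprK x) replf_cls.
rewrite -[RHS]/(replf g i (replf f i (cls (repr x)))) !replf_cls.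
by congr cls; elim: (repr x) => {i x} //= *; congruence.
Qed.

Lemma replf_qi M N (f : dgmap M N) : quasi_iso f -> quasi_iso (replf f).
Proof.
move=> q; apply: (qi_cancel_l (eps_qi N)); rewrite eps_nat.
exact: qi_comp (eps_qi M) q.
Qed.
End Replacement.

(** * Shifts and cones *)

Section Shift.
Context (k : comPzRingType) (A : dgalg k).
Implicit Types M N P V : dgmod A.

Lemma cd_erefl (C : cplx k) i j (h : i + 1 = j) (x : C i) :
  cd h x = 0 -> cd (erefl (i + 1)) x = 0.
Proof. by case: _ / h. Qed.

Lemma mcast_lin N i j (h : i = j) : linear (@mcast k A N i j h).
Proof. by case: _ / h. Qed.

Lemma mcast_cd N i i' j j' (e : i = i') (e' : j = j') (h : i + 1 = j)
    (h' : i' + 1 = j') (x : N i) : cd h' (mcast e x) = mcast e' (cd h x).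
Proof.
by case: _ / e h'; case: _ / e' => h'; rewrite (eq_irrelevance h' h).
Qed.

Lemma mcast_act N i i' j l l' (e : i = i') (e' : l = l') (h : i + j = l)
    (h' : i' + j = l') (x : N i) a :
  mact h' (mcast e x) a = mcast e' (mact h x a).
Proof.
by case: _ / e h'; case: _ / e' => h'; rewrite (eq_irrelevance h' h).
Qed.

Lemma mcast_id N i (e : i = i) (x : N i) : mcast e x = x.
Proof. by rewrite (eq_irrelevance e erefl). Qed.

Lemma mcastK N i j (e : i = j) (e' : j = i) (x : N i) :
  mcast e' (mcast e x) = x.
Proof. by case: _ / e e' => e'; rewrite mcast_id. Qed.

Lemma mf_mcast M N (f : dgmap M N) i j (e : i = j) x :
  f j (mcast e x) = mcast e (f i x).
Proof. by case: _ / e. Qed.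

Lemma hf_mcast M N n (f : hom M N n) p p' q (e : p = p') (h : p + n = q)
    (h' : p' + n = q) x : f p' q h' (mcast e x) = f p q h x.
Proof. by case: _ / e h' => h'; rewrite (eq_irrelevance h' h). Qed.

Lemma mcast_hf M N n (f : hom M N n) p q q' (e : q = q') (h : p + n = q)
    (h' : p + n = q') x : mcast e (f p q h x) = f p q' h' x.
Proof. by case: _ / e h' => h'; rewrite (eq_irrelevance h' h). Qed.

Lemma idx_shiftn (n i j l : int) : i + j = l -> (i + n) + j = l + n.
Proof. lia. Qed.

(** Shifts by -1, by 0 and by the degree of a cochain all occur below. [shiftn 0 M] is only
    isomorphic to [M], because [i + 0] does not reduce to [i]; hence [unshiftn0]. *)
Definition shiftn (n : int) M : dgmod A.
Proof.
pose C := @Cplx k (fun i => M (i + n))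
  (fun i j h x => ksign k n *: cd (idx_shiftn n h) x).
unshelve refine
  (@DgMod k A (C _ _) (fun i j l h x a => mact (idx_shiftn n h) x a) _).
- by move=> i j h a x y /=; rewrite (cd_lin _) scalerDr !scalerA mulrC.
- by move=> i j l h h' x /=; rewrite (linZ (cd_lin _)) cdd !scaler0.
split=> /=.
- by move=> *; apply: (dact_linl (mactP M)).
- by move=> *; apply: (dact_linr (mactP M)).
- by move=> *; apply: (dactA (mactP M)).
- by move=> *; apply: (dact1 (mactP M)).
- move=> i j l i' j' l' h hi hj hl h1 h2 x a.
  rewrite (dleib (mactP M) _ (idx_shiftn n hi) hj _ (idx_shiftn n h1)
    (idx_shiftn n h2)).
  rewrite (linZ (dact_linl (mactP M) _ _)) scalerDr !scalerA ksignD.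
  by congr (_ + _ *: _); rewrite mulrCA ksignK mulr1.
Defined.

Definition shiftnf n M N (f : dgmap M N) : dgmap (shiftn n M) (shiftn n N).
Proof.
exists (fun i (x : shiftn n M i) => f (i + n) x).
- by move=> i a x y; apply: (mf_lin f).
- by move=> i j h x /=; rewrite mfZ mf_d.
- by move=> i j l h x a; apply: (mf_act f).
Defined.

Lemma cycle_shiftn n M i (x : shiftn n M i) :
  cd (erefl (i + 1)) x = 0 <-> cd (erefl (i + n + 1)) (x : M (i + n)) = 0.
Proof.
split=> /= [e|/cd_any ->]; last by rewrite scaler0.
apply: (@cd_erefl _ _ _ (idx_shiftn n (erefl (i + 1)))).
by rewrite -[LHS]scale1r -(ksignK k n) -scalerA e scaler0.
Qed.

Lemma coh_shiftn n M i (x y : shiftn n M i) :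
  coh x y <-> coh (x : M (i + n)) (y : M (i + n)).
Proof.
split=> [[h [e [z /= ->]]]|].
  apply: (@cohI _ _ _ _ _ _ (idx_shiftn n e) (ksign k n *: z)).
  by rewrite (linZ (cd_lin _)).
have e : (i - 1) + 1 = i by lia.
case/(cohE (idx_shiftn n e)) => z ->.
apply: (@cohI _ (shiftn n M) _ _ _ _ e (ksign k n *: z)) => /=.
by rewrite (linZ (cd_lin _)) scalerA ksignK scale1r.
Qed.

Lemma shiftnf_qi n M N (f : dgmap M N) : quasi_iso f -> quasi_iso (shiftnf n f).
Proof.
case/quasi_isoE => inj sur; apply/quasi_isoE; split=> i x /cycle_shiftn dx.
  by move=> /coh_shiftn fx; apply/coh_shiftn/inj.
have [y dy c] := sur _ _ dx.
by exists y; [apply/cycle_shiftn|apply/coh_shiftn].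
Qed.

Lemma acyc_shiftn n M : acyc M -> acyc (shiftn n M).
Proof.
by move=> /acycE a; apply/acycE => i x /cycle_shiftn dx; apply/coh_shiftn/a.
Qed.

Lemma shift_cycle M i (x : shift M i) :
  cd (erefl (i + 1)) x = 0 <-> cd (erefl (i + 1 + 1)) (x : M (i + 1)) = 0.
Proof.
split=> /= [/eqP|/cd_any ->]; last by rewrite oppr0.
by rewrite oppr_eq0 => /eqP /cd_erefl.
Qed.

Lemma shift_coh M i (x y : shift M i) :
  coh x y <-> coh (x : M (i + 1)) (y : M (i + 1)).
Proof.
split=> [[h [e [z /= ->]]]|].
  apply: (@cohI _ _ _ _ _ _ (idx_shift e) (- z)).
  by rewrite (linN (cd_lin _)).
have e : (i - 1) + 1 = i by lia.
case/(cohE (idx_shift e)) => z ->.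
by apply: (@cohI _ (shift M) _ _ _ _ e (- z)) => /=;
  rewrite (linN (cd_lin _)) opprK.
Qed.

Lemma acyc_shift M : acyc M -> acyc (shift M).
Proof.
by move=> /acycE a; apply/acycE => i x /shift_cycle dx; apply/shift_coh/a.
Qed.

Lemma shiftf_qi_inv M N (f : dgmap M N) : quasi_iso (shiftf f) -> quasi_iso f.
Proof.
have E (i : int) : (i - 1) + 1 = i by lia.
case/quasi_isoE => inj sur; apply/quasi_isoE; split=> i.
  case: _ / (E i) => x dx fx; apply/shift_coh/inj; first exact/shift_cycle.
  exact/shift_coh.
case: _ / (E i) => y dy; have [|x dx c] := sur _ y; first exact/shift_cycle.
by exists x; [apply/shift_cycle|apply/shift_coh].
Qed.

Definition unshiftn0 M : dgmap (shiftn 0 M) M.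
Proof.
exists (fun i (x : shiftn 0 M i) => mcast (addr0 i) x).
- by move=> i a x y; apply: (@mcast_lin M).
- move=> i j h x /=; rewrite ksign0 scale1r.
  by rewrite (mcast_cd _ (addr0 j) (idx_shiftn 0 h)).
- by move=> i j l h x a /=; rewrite (mcast_act _ (addr0 l) (idx_shiftn 0 h)).
Defined.

Lemma mcast_inj0 M i j (e : i = j) (x : M i) : mcast e x = 0 -> x = 0.
Proof. by case: _ / e. Qed.

Lemma unshiftn0_surj M i y : exists x, unshiftn0 M i x = y.
Proof. by exists (mcast (esym (addr0 i)) y : M (i + 0)); apply: mcastK. Qed.

Lemma unshiftn0_qi M : quasi_iso (unshiftn0 M).
Proof.
by apply: bij_qi => [i x /mcast_inj0 //|i y]; apply: unshiftn0_surj.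
Qed.

Lemma idxB1 (i : int) : i + 1 + (- 1) = i.
Proof. exact: addrK. Qed.

Definition shift_unshift M : dgmap (shift (shiftn (- 1) M)) M.
Proof.
exists (fun i (x : shift (shiftn (- 1) M) i) => mcast (idxB1 i) (x : M _)).
- by move=> i a x y; apply: (@mcast_lin M).
- move=> i j h x /=; rewrite [ksign _ _]expr1 scaleN1r opprK.
  by rewrite (mcast_cd _ (idxB1 j) (idx_shiftn (- 1) (idx_shift h))).
- move=> i j l h x a /=.
  by rewrite (mcast_act _ (idxB1 l) (idx_shiftn (- 1) (idx_shift h))).
Defined.

Lemma shift_unshift_qi M : quasi_iso (shift_unshift M).
Proof.
apply: bij_qi => [i x /mcast_inj0 //|i y].
by exists (mcast (esym (idxB1 i)) y : M _); apply: mcastK.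
Qed.
End Shift.

(** * Rearrangements in abelian groups for the element chases below *)

Section Zmod.
Context (V : zmodType).
Implicit Types x y z t u : V.

Lemma zmod_eq1 x y z t u : x + z = t + u -> x + y + z - t = y + u.
Proof.
by move=> e; rewrite (addrAC x) e [_ + y]addrC -addrA [t + u]addrC addrK.
Qed.

Lemma zmod_eq2 x t u : x = t - u + (x + u - t).
Proof. by rewrite addrC -addrA (addrA (- t)) addNr add0r addrK. Qed.

Lemma zmod_eq3 x y z t u : x + y + z = t + u -> x - (t - z) = - y + u.
Proof.
move=> e; have -> : u = x + y + z - t by rewrite e addrC addKr.
by rewrite opprB (addrC x y) -!addrA addKr.
Qed.

Lemma zmod_eq4 x t z : x - (x - t + z) = t - z.
Proof. by rewrite opprD addrA subKr. Qed.
End Zmod.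

(** * Acyclicity of cones and the five lemma *)

Section ConeLemmas.
Context (k : comPzRingType) (A : dgalg k).
Implicit Types M N P V : dgmod A.

Section ConeMap.
Context (M N M' N' : dgmod A) (f : dgmap M N) (f' : dgmap M' N')
  (a : dgmap M M') (b : dgmap N N').
Hypothesis ab : dgcomp b f = dgcomp f' a.

Lemma conemap_sq i x : b i (f i x) = f' i (a i x).
Proof. exact: (congr1 (fun g : dgmap M N' => g i x) ab). Qed.

Definition conemap : dgmap (cone f) (cone f').
Proof.
exists (fun i (x : cone f i) => (a (i + 1) x.1, b i x.2) : cone f' i).
- by move=> i c x y /=; rewrite (mf_lin a) (mf_lin b).
- move=> i j h x /=; rewrite /cone_d /= mfN mf_d mfD mf_d.
  by rewrite mf_mcast conemap_sq.
- by move=> i j l h x c /=; rewrite !mf_act.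
Defined.
End ConeMap.

Section Cone.
Context (M N : dgmod A) (f : dgmap M N).

Lemma cone_dE i j (h : i + 1 = j) (x : cone f i) :
  cd h x = (- cd (idx_shift h) x.1, mcast h (f (i + 1) x.1) + cd h x.2)
    :> cone f j.
Proof. by []. Qed.

Lemma cone_cycle i (x : cone f i) : cd (erefl (i + 1)) x = 0 <->
  cd (erefl (i + 1 + 1)) (x.1 : M _) = 0
  /\ f (i + 1) x.1 + cd (erefl (i + 1)) (x.2 : N _) = 0.
Proof.
split=> [e|[e1 e2]].
  split; last exact: (congr1 snd e).
  apply: (@cd_erefl _ _ _ _ (idx_shift (erefl (i + 1)))); apply/eqP.
  by rewrite -oppr_eq0; apply/eqP/(congr1 fst e).
by rewrite cone_dE (cd_any _ e1) mcast_id oppr0 e2.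
Qed.

Lemma cone_coh0 (h : int) (x : cone f (h + 1)) : coh x 0 <->
  exists (u1 : M (h + 1)) (u2 : N h),
    [/\ x.1 = - cd (erefl (h + 1 + 1)) u1
      & x.2 = f _ u1 + cd (erefl (h + 1)) u2].
Proof.
split.
  case/(cohE erefl) => z; rewrite add0r cone_dE => ->.
  exists z.1, z.2; split=> //=.
  by rewrite (eq_irrelevance (idx_shift _) erefl).
case: x => x1 x2 [u1 [u2 [/= -> ->]]].
apply: (@cohI _ _ _ _ _ _ (erefl (h + 1)) ((u1, u2) : cone f h)).
rewrite add0r cone_dE mcast_id /=.
by rewrite (eq_irrelevance (idx_shift _) erefl).
Qed.

(** The long exact sequence of the cone, by elements. A cycle [(x1, x2)] has [f x1 = - d x2], so
    [x1 = d w] by injectivity, and surjectivity applies to the cycle [x2 + f w]. Conversely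
    [f x = d y] yields the cycle [(x, - y)], and a cycle [y] of [N] yields [(0, y)]. *)
Lemma qi_acyc_cone : quasi_iso f <-> acyc (cone f).
Proof.
split=> [/quasi_isoE [inj sur]|ac].
  (* Writing the degree as a successor lets primitives live in degree [i - 1] with proof [erefl], so
     that no cast arises. The same device recurs below. *)
  apply/acycE => i; have E : (i - 1) + 1 = i by lia.
  case: _ / E => -[x1 x2] /cone_cycle [/= dx1 dx2].
  have fx1 : f _ x1 = - cd erefl x2 by apply/eqP; rewrite -addr_eq0 dx2.
  have [w ew] : exists w, x1 = cd (erefl (i - 1 + 1 + 1)) w.
    have /(inj _ _ dx1)/(cohE erefl) [w ew] : coh (f _ x1) 0.
      apply: (@cohI _ _ _ _ _ _ erefl (- x2)).
      by rewrite add0r fx1 (linN (cd_lin _)).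
    by exists w; rewrite ew add0r.
  have dx2w : cd erefl (x2 + f _ w) = 0.
    by rewrite (linD (cd_lin _)) -mf_d -ew [LHS]addrC dx2.
  have [y dy /(cohE erefl) [z ez]] := sur _ _ dx2w.
  apply/cone_coh0; exists (y - w), z; split=> /=.
    by rewrite (linB (cd_lin _)) dy sub0r opprK.
  by apply: (addIr (f _ w)); rewrite ez mfB [RHS]addrAC (subrK (f _ w)).
apply/quasi_isoE; split=> i.
  have E : (i - 1) + 1 = i by lia.
  case: _ / E => x dx /(cohE erefl) [y]; rewrite add0r => fx.
  move: (i - 1) x dx y fx => h; have E : (h - 1) + 1 = h by lia.
  case: _ / E => x dx y fx; set w := (x, - y) : cone f _.
  have /cone_coh0 [u1 [u2 [/= -> _]]] : coh w 0.
    apply/(acycE _).1 => //; apply/cone_cycle; split=> //=.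
    by rewrite (linN (cd_lin _)) fx subrr.
  apply: (@cohI _ _ _ _ _ _ erefl (- u1)).
  by rewrite add0r (linN (cd_lin _)).
have E : (i - 1) + 1 = i by lia.
case: _ / E => y dy; set w := (0, y) : cone f _.
have /cone_coh0 [u1 [u2 [/= /eqP e1 e2]]] : coh w 0.
  apply/(acycE _).1 => //; apply/cone_cycle; split=> /=.
    by rewrite (lin0 (cd_lin _)).
  by rewrite mf0 dy addr0.
exists u1; last exact: (@cohI _ _ _ _ _ _ erefl u2).
by apply/eqP; move: e1; rewrite eq_sym oppr_eq0.
Qed.

Lemma cone_in_qi : acyc M -> quasi_iso (cone_in f).
Proof.
move=> aM; apply/quasi_isoE; split=> i; have E : (i - 1) + 1 = i by lia.
  case: _ / E => y dy /cone_coh0 [u1 [u2 [/= /eqP e1 ->]]].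
  have [|w ->] := aM _ _ (erefl (i - 1 + 1)) u1.
    by apply/eqP; move: e1; rewrite eq_sym oppr_eq0.
  apply: (@cohI _ _ _ _ _ _ erefl (f _ w + u2)).
  by rewrite add0r (linD (cd_lin _)) mf_d.
case: _ / E => -[x1 x2] /cone_cycle [/= dx1 dx2].
have [w ew] := aM _ _ (erefl (i - 1 + 1 + 1)) x1 dx1.
exists (x2 + f _ w).
  by rewrite (linD (cd_lin _)) -mf_d -ew [LHS]addrC dx2.
apply/coh_subr0/cone_coh0; exists (- w), 0; split=> /=.
  by rewrite subr0 (linN (cd_lin _)) opprK.
by rewrite (lin0 (cd_lin _)) addr0 mfN opprD addrA subrr add0r.
Qed.

Lemma cone_out_qi : acyc N -> quasi_iso (cone_out f).
Proof.
move=> aN; apply/quasi_isoE; split=> i.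
  have E : (i - 1) + 1 = i by lia.
  case: _ / E => -[x1 x2] /cone_cycle [/= dx1 dx2].
  case/(cohE erefl) => /= u; rewrite add0r => ex1.
  rewrite (eq_irrelevance (idx_shift _) erefl) in ex1.
  have [|z ez] := aN _ _ (erefl (i - 1 + 1)) (x2 - f _ u).
    rewrite (linB (cd_lin _)) -mf_d -[cd _ u]opprK -ex1 mfN opprK [LHS]addrC.
    exact: dx2.
  apply/cone_coh0; exists u, z; split=> //=.
  by rewrite -ez [RHS]addrC [RHS]subrK.
move=> x1 /shift_cycle dx1.
have [|z ez] := aN _ _ (erefl (i + 1)) (f _ x1).
  by rewrite -mf_d dx1 mf0.
exists ((x1, - z) : cone f i); last exact: coh_refl.
by apply/cone_cycle; split=> //=; rewrite (linN (cd_lin _)) ez subrr.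
Qed.
End Cone.

Lemma acyc_cone M N (f : dgmap M N) : acyc M -> acyc N -> acyc (cone f).
Proof. by move=> aM aN; apply/qi_acyc_cone/acyc_qi. Qed.

(** The five lemma by elements: the first component is corrected using [a], at the cost of images
    under [f] or [f'] in the second one, which is then corrected using [b]. *)
Lemma conemap_qi M N M' N' (f : dgmap M N) (f' : dgmap M' N')
    (a : dgmap M M') (b : dgmap N N') (ab : dgcomp b f = dgcomp f' a) :
  quasi_iso a -> quasi_iso b -> quasi_iso (conemap ab).
Proof.
case/quasi_isoE => ainj asur /quasi_isoE [binj bsur].
apply/quasi_isoE; split=> i; have E : (i - 1) + 1 = i by lia.
  case: _ / E => -[x1 x2] /cone_cycle [/= dx1 dx2].
  case/cone_coh0 => u1 [u2 [/= e1 e2]].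
  have /(ainj _ _ dx1)/(cohE erefl) [w] : coh (a _ x1) 0.
    apply: (@cohI _ _ _ _ _ _ erefl (- u1)).
    by rewrite add0r (linN (cd_lin _)).
  rewrite add0r => ew.
  have dw : cd erefl (u1 + a _ w) = 0.
    by rewrite (linD (cd_lin _)) -mf_d -ew e1 subrr.
  have [t dt /(cohE erefl) [s es]] := asur _ _ dw.
  have d2 : cd erefl (x2 + f _ w - f _ t) = 0.
    rewrite (linB (cd_lin _)) (linD (cd_lin _)) -!mf_d dt mf0 subr0 -ew.
    rewrite [LHS]addrC.
    exact: dx2.
  have /(binj _ _ d2)/(cohE erefl) [z] : coh (b _ (x2 + f _ w - f _ t)) 0.
    apply: (@cohI _ _ _ _ _ _ erefl (u2 + f' _ s)).
    rewrite add0r mfB mfD e2 !(conemap_sq ab) (linD (cd_lin _)) -mf_d.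
    by apply: zmod_eq1; rewrite -!mfD es.
  rewrite add0r => ez; apply/cone_coh0; exists (t - w), z; split=> /=.
    by rewrite (linB (cd_lin _)) dt sub0r opprK.
  by rewrite -ez mfB; apply: zmod_eq2.
case: _ / E => -[y1 y2] /cone_cycle [/= dy1 dy2].
have [x1 dx1 /(cohE erefl) [u eu]] := asur _ _ dy1.
have dd : cd erefl (y2 + f' _ u) = - b _ (f _ x1).
  apply/eqP; rewrite -addr_eq0 (linD (cd_lin _)) -mf_d (conemap_sq ab).
  by apply/eqP; rewrite -[LHS]addrA -mfD [cd _ u + _]addrC -eu [LHS]addrC.
have dfx : cd erefl (f _ x1) = 0 by rewrite -mf_d dx1 mf0.
have /(binj _ _ dfx)/(cohE erefl) [z] : coh (b _ (f _ x1)) 0.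
  apply: (@cohI _ _ _ _ _ _ erefl (- (y2 + f' _ u))).
  by rewrite add0r (linN (cd_lin _)) dd opprK.
rewrite add0r => fx1.
have d3 : cd erefl (y2 + f' _ u + b _ z) = 0.
  by rewrite (linD (cd_lin _)) dd -mf_d -fx1 addNr.
have [t dt /(cohE erefl) [s es]] := bsur _ _ d3.
exists ((x1, t - z) : cone f _).
  apply/cone_cycle; split=> //=.
  by rewrite (linB (cd_lin _)) dt sub0r fx1 subrr.
apply/coh_subr0/cone_coh0; exists (- u), s; split=> /=.
  by rewrite (linN (cd_lin _)) opprK eu [LHS]addrAC subrr add0r.
by rewrite mfN mfB; apply: zmod_eq3.
Qed.
End ConeLemmas.

(** * K-projective modules *)

Lemma sign_cancel (k : comPzRingType) (V : lmodType k) (c : k) (x y : V) :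
  c * c = 1 -> - c *: (y - c *: (x + c *: y)) = x.
Proof.
move=> cc; rewrite [c *: (x + _)]scalerDr scalerA cc scale1r opprD addrCA subrr.
by rewrite addr0 scalerN scaleNr opprK scalerA cc scale1r.
Qed.

Section KProjective.
Context (k : comPzRingType) (A : dgalg k).
Implicit Types M N P V : dgmod A.

Definition hpre V M N (f : dgmap M N) n (a : hom N V n) : hom M V n.
Proof.
exists (fun p q h x => a p q h (f p x)).
- by move=> p q h c x y; rewrite (mf_lin f) (hf_lin a).
- by move=> p q j p' q' h hp hq h' x c; rewrite mf_act (hf_act a h hp hq).
Defined.

Definition hom_pre S (U : dgbimod A S) M N (f : dgmap M N) :
  dgmap (hom_bimod U N) (hom_bimod U M).
Proof.
exists (fun n (a : hom_bimod U N n) => hpre f a : hom_bimod U M n).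
- by move=> n c a b; apply: homP.
- move=> i j h a; apply: homP => p q e x /=.
  by rewrite /hd_fun /= mf_d.
- by move=> i j l h a s; apply: homP.
Defined.

(** Preferred to cofibrancy because it is a condition on Hom complexes, hence passes to shifted
    cones through [xi]. *)
Definition kproj P : Prop := forall V, acyc V -> acyc (homcx P V).

Lemma hom_cycle M V n (f : hom M V n) :
  cd (erefl (n + 1)) (f : homcx M V n) = 0 ->
  forall p q r s (hr : p + n = r) (hr' : r + 1 = q) (hs : p + 1 = s)
    (hs' : s + n = q) x,
  cd hr' (f p r hr x) = ksign k n *: f s q hs' (cd hs x).
Proof.
move=> df p q r s hr hr' hs hs' x; have h : p + (n + 1) = q by lia.
have := congr1 (fun g : hom M V (n + 1) => g p q h x) df.
rewrite hom0E /= (hd_funE _ _ _ _ hr hr' hs hs') => /eqP.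
by rewrite subr_eq0 => /eqP.
Qed.

Lemma mcast_cdr N i j j' (e' : j = j') (h : i + 1 = j) (h' : i + 1 = j')
  (x : N i) : mcast e' (cd h x) = cd h' x.
Proof. by rewrite -(mcast_cd erefl e' h h'). Qed.

(* A cocycle of [Hom^(h+1)(P, V)] is a map from [P] to a shift of [V]; when [V]
   is acyclic it lifts to the cone of an identity map, and the second component
   of the lift is a primitive. *)
Lemma cofibrant_kproj P : cofibrant P -> kproj P.
Proof.
move=> cP V aV h i e f df; pose N' := shiftn h V.
have ei (p : int) : p + i = p + 1 + h by lia.
have ki : ksign k i = - ksign k h by rewrite -e ksignS.
unshelve epose (fh := @DgMap k A P (shift N')
  (fun p (x : P p) => f p (p + 1 + h) (ei p) x) _ _ _).
- by move=> p; apply: (hf_lin f).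
- move=> p q hpq x /=; have e1 : p + 1 + h + 1 = q + 1 + h by lia.
  have -> : cd (idx_shiftn h (idx_shift hpq)) (f p (p + 1 + h) (ei p) x)
    = ksign k i *: f q (q + 1 + h) (ei q) (cd hpq x) by exact: hom_cycle.
  by rewrite ki scaleNr scalerN scalerA ksignK scale1r opprK.
- by move=> p j l hp x a; apply: (hf_act f (ei p) hp).
have aN : acyc N' by exact: acyc_shiftn.
have aC : acyc (cone (dgid N')) by exact: acyc_cone.
(* Since [N'] is acyclic, the projection from the cone of its identity is a surjection between
   acyclic modules, hence a trivial fibration. *)
have [|H eH] := cP _ _ (cone_out (dgid N')) _ (acyc_qi _ aC (acyc_shift aN)) fh.
  by move=> ? y; exists ((y, 0) : cone (dgid N') _).
unshelve epose (g := @Hom k A P V h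
  (fun p q e0 (x : P p) => mcast (N := V) e0 (H p x).2) _ _).
- by move=> p q e0 c x y; rewrite (mf_lin H) /= (@mcast_lin _ _ V).
- move=> p q j p' q' e0 hp hq h' x a /=; rewrite (mf_act H) /=.
  by rewrite (mcast_act _ h' (idx_shiftn h hp)).
(* Up to casts, the second component of [H (d x)] is [f x] plus [ksign k h] times [d (g x)]; the
   differential of [g] is therefore [- ksign k h] times [f]. *)
exists (- ksign k h *: (g : homcx P V h)).
rewrite (linZ (cd_lin e)); apply: homP => p q e0 x; rewrite homZE /=.
have e1 : p + h + 1 = q by lia.
have e2 : p + 1 + h = q by lia.
rewrite (hd_funE _ _ _ _ erefl e1 erefl e2) /= (mf_d H) /=.
rewrite (linD (@mcast_lin _ _ V _ _ _)).
rewrite (linZ (@mcast_lin _ _ V _ _ _)) (mcast_cdr _ _ e1).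
have -> : (H p x).1 = f p (p + 1 + h) (ei p) x by exact: eH.
by rewrite mcast_hf sign_cancel // ksignK.
Qed.

Section Contract.
Context (P V : dgmod A) (m n l : int) (e : m + n = l) (a : hom P V m)
  (s : hom P P n).

Definition hcomp_fun p q (h : p + l = q) (x : P p) : V q :=
  a (p + n) q (idx_act (eq_addC e) h erefl) (s p (p + n) erefl x).

Lemma hcomp_funE p q (h : p + l = q) x r (hr : p + n = r) (hr' : r + m = q) :
  hcomp_fun h x = a r q hr' (s p r hr x).
Proof.
case: _ / hr hr' => hr'; rewrite /hcomp_fun.
by rewrite (eq_irrelevance hr' (idx_act (eq_addC e) h erefl)).
Qed.

Lemma hcomp_lin p q (h : p + l = q) : linear (hcomp_fun h).
Proof. by move=> c x y; rewrite /hcomp_fun (hf_lin s) (hf_lin a). Qed.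

Lemma hcomp_act p q i p' q' (h : p + l = q) (hp : p + i = p')
    (hq : q + i = q') (h' : p' + l = q') x c :
  hcomp_fun h' (mact hp x c) = mact hq (hcomp_fun h x) c.
Proof.
have e1 : p + n + m = q by lia.
have e2 : p + n + i = p' + n by lia.
have e3 : p' + n + m = q' by lia.
rewrite (hcomp_funE h x erefl e1) (hcomp_funE h' _ erefl e3).
by rewrite (hf_act s erefl hp e2) (hf_act a e1 e2 hq).
Qed.

Definition hcomp : hom P V l := Hom hcomp_lin hcomp_act.
End Contract.

(* The identity of [P] is a coboundary, that is, [P] is contractible. *)
Lemma acyc_kproj_hom P V : kproj P -> acyc P -> acyc (homcx P V).
Proof.
move=> kP aP h i e a da.
have d1 : cd (erefl (0 + 1)) (@h1 k A P : homcx P P 0) = 0.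
  apply: homP => p q hp x; rewrite hom0E [LHS]/=.
  have e2 : p + 1 + 0 = q by lia.
  rewrite (hd_funE _ _ _ _ (addr0 p) hp hp (addr0 q)) !h1E.
  by rewrite ksign0 scale1r subrr.
have [s es] := kP P aP (- 1) 0 (addNr 1) (@h1 k A P) d1.
have ei : i + (- 1) = h by lia.
have ki : ksign k i = - ksign k h by rewrite -e ksignS.
(* With [d s = 1] and [d a = 0], the Leibniz rule gives [d (a s) = (-1)^i a]. *)
exists (ksign k i *: (hcomp ei a s : homcx P V h)).
rewrite (linZ (cd_lin e)); apply: homP => p q hp x; rewrite homZE /=.
have e1 : p + h + 1 = q by lia.
have e2 : p + 1 + h = q by lia.
have e3 : p + 1 + (- 1) = p by lia.
have e4 : p + (- 1) + i = p + h by lia.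
have e5 : p + (- 1) + 1 = p by lia.
have ex : x = cd e5 (s p (p + (- 1)) erefl x) + s (p + 1) p e3 (cd erefl x).
  have := congr1 (fun g : hom P P 0 => g p p (addr0 p) x) es.
  rewrite h1E /= (hd_funE _ _ _ _ erefl e5 erefl e3).
  by rewrite [ksign _ _]expr1 scaleN1r opprK.
rewrite (hd_funE _ _ _ _ erefl e1 erefl e2) /=.
rewrite (hcomp_funE _ _ _ _ _ erefl e4) (hcomp_funE _ _ _ _ _ e3 hp).
rewrite (hom_cycle da e4 e1 e5 hp) scalerBr !scalerA ksignK scale1r.
rewrite ki mulNr ksignK scaleN1r opprK.
by rewrite [in LHS]ex (linD (hf_lin a _)).
Qed.
End KProjective.

(** * Hom out of a shifted cone *)

Lemma comb_linear (k : comPzRingType) (V : lmodType k) (a b c : k)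
    (x y z t : V) :
  a *: (c *: x + y) + b *: (c *: z + t)
  = c *: (a *: x + b *: z) + (a *: y + b *: t).
Proof. by rewrite !scalerDr !scalerA addrACA !(mulrC c). Qed.

(** The sign check behind [xi_hom_d]: [A], [B] and [C] stand for the signs of [n], [s] and [n * s],
    as in [xi_sign]. *)
Lemma xi_lmod (k : comPzRingType) (V : lmodType k) (A B C : k)
  (T1 T2 T3 T4 T5 : V) : A * A = 1 -> B * B = 1 ->
  (C * A) *: (- B *: (T3 + (T1 - (- (A * B)) *: T2)))
    + (C * B) *: (- B *: - (T4 - (A * B) *: T5))
  = (- (C * A * B)) *: T1 + C *: T4
    - A *: ((- (C * A * B)) *: (B *: - T2) + C *: (B *: (T3 + T5))).
Proof.
move=> AA BB.
rewrite !(scalerDr, scalerN, scalerA).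
have -> : C * A * - B = - (C * A * B) by ring.
have -> : - (C * A * B) * - (A * B) = C by ring: AA BB.
have -> : C * B * - B = - C by ring: BB.
have -> : - C * (A * B) = - (C * A * B) by ring.
have -> : A * - (C * A * B) * B = - C by ring: AA BB.
have -> : A * (C * B) = C * A * B by ring.
rewrite !scaleNr !opprD !opprK.
move: (- (_ *: T3)) (- (_ *: T1)) (- (_ *: T2)) (_ *: T4) (- (_ *: T5)).
move=> x3 x1 x2 x4 x5; rewrite (addrC x3) -!addrA; congr (_ + _).
by rewrite (addrCA x3) (addrCA x2).
Qed.

(* For [f : M -> N], the isomorphism between [cone(f^* )[s']] and
   [Hom(cone(f)[s], U)], where [s + s' = -1].  The signs in [xi_fun] are forced, up
   to a common one, by compatibility with the differentials and with [S]. *)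
Section Xi.
Context (k : comPzRingType) (A S : dgalg k) (U : dgbimod A S).
Context (M N : dgmod A) (f : dgmap M N) (s s' : int) (ss' : s + s' + 1 = 0).

Let X := shiftn s (cone f).
Let Y := shiftn s' (cone (hom_pre U f)).

Lemma xi_idx1 n p q : p + n = q -> p + s + 1 + (n + s') = q.
Proof. lia. Qed.
Lemma xi_idx2 n p q : p + n = q -> p + s + (n + s' + 1) = q.
Proof. lia. Qed.

Definition xi_fun n (a : Y n) p q (h : p + n = q) (x : X p) : U q :=
  ksign k ((n + 1) * (s + 1)) *:
    (a.2 : hom M (bimod1 U) (n + s')) _ q (xi_idx1 h) x.1
  + ksign k (n * s) *:
    (a.1 : hom N (bimod1 U) (n + s' + 1)) _ q (xi_idx2 h) x.2.

Lemma xi_fun_lin n (a : Y n) p q (h : p + n = q) : linear (xi_fun a h).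
Proof.
move=> c x y; rewrite /xi_fun /=.
rewrite (hf_lin (a.2 : hom M (bimod1 U) (n + s'))).
rewrite (hf_lin (a.1 : hom N (bimod1 U) (n + s' + 1))).
by rewrite !scalerDr !scalerA addrACA !(mulrC c).
Qed.

Lemma xi_fun_act n (a : Y n) p q j p' q' (h : p + n = q) (hp : p + j = p')
    (hq : q + j = q') (h' : p' + n = q') (x : X p) c :
  xi_fun a h' (mact hp x c) = mact (d := bimod1 U) hq (xi_fun a h x) c.
Proof.
rewrite /xi_fun /= (linD (dact_linl (bact1P U) _ _)).
rewrite !(linZ (dact_linl (bact1P U) _ _)).
rewrite (hf_act (a.2 : hom M (bimod1 U) (n + s')) (xi_idx1 h) _ hq).
by rewrite (hf_act (a.1 : hom N (bimod1 U) (n + s' + 1)) (xi_idx2 h) _ hq).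
Qed.

Definition xi_hom n (a : Y n) : hom_bimod U X n :=
  @Hom k A X (bimod1 U) n (@xi_fun n a) (@xi_fun_lin n a) (@xi_fun_act n a).

Lemma mcast_hom (P : dgmod A) m n (e : m = n) (a : hom_bimod U P m) p q
  (h : p + n = q) (h' : p + m = q) x :
  (mcast e a : hom P (bimod1 U) n) p q h x = (a : hom P (bimod1 U) m) p q h' x.
Proof. by case: _ / e h => h; rewrite (eq_irrelevance h h'). Qed.

Lemma xi_sign n : let A := ksign k n in let B := ksign k s in
  let C := ksign k (n * s) in
  [/\ ksign k ((n + 1) * (s + 1)) = - (C * A * B),
      ksign k ((n + 1 + 1) * (s + 1)) = C * A,
      ksign k ((n + 1) * s) = C * B, ksign k s' = - B &
      ksign k (n + s') = - (A * B)].
Proof.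
have es : ksign k s' = - ksign k s.
  by rewrite -ksignS; apply: (@ksign_even _ _ _ (- s - 1)); lia.
split=> //.
- rewrite -!ksignD -ksignS; congr ksign; ring.
- rewrite -!ksignD; apply: (@ksign_even _ _ _ (s + 1)); ring.
- rewrite -!ksignD; congr ksign; ring.
- by rewrite ksignD es mulrN.
Qed.

Lemma xi_hom_d n n' (h : n + 1 = n') (a : Y n) :
  xi_hom (cd h a) = cd h (xi_hom a).
Proof.
case: _ / h; apply: homP => p q e x /=.
have e1 : p + n + 1 = q by lia.
have e2 : p + 1 + n = q by lia.
rewrite (hd_funE _ _ _ _ erefl e1 erefl e2) /= /xi_fun /=.
set a1 := (a.1 : hom N (bimod1 U) (n + s' + 1)).
set a2 := (a.2 : hom M (bimod1 U) (n + s')).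
have e3 : p + s + 1 + (n + s') + 1 = q by lia.
have e4 : p + s + 1 + 1 + (n + s') = q by lia.
have e5 : p + s + (n + s' + 1) + 1 = q by lia.
have e6 : p + s + 1 + (n + s' + 1) = q by lia.
rewrite (mcast_hom (P := M) _ _ _ e6) /=.
rewrite (hd_funE (idx_shiftn s' erefl) a2 _ _ (xi_idx1 erefl) e1
  (idx_shift (idx_shiftn s erefl)) (xi_idx1 e2)).
rewrite (hd_funE (idx_shift (idx_shiftn s' erefl)) a1 _ _ (xi_idx2 erefl) e1
  (idx_shiftn s erefl) (xi_idx2 e2)).
rewrite (linD (cd_lin _)) !(linZ (cd_lin _)).
rewrite !(linZ (hf_lin a1 _)) !(linZ (hf_lin a2 _)) (linN (hf_lin a2 _)).
rewrite (linD (hf_lin a1 _)) (hf_mcast _ _ e6).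
have [-> -> -> -> ->] := xi_sign n.
have -> : ksign k (n + s' + 1) = ksign k n * ksign k s.
  by have [_ _ _ _ e0] := xi_sign n; rewrite ksignS e0 opprK.
by apply: xi_lmod; apply: ksignK.
Qed.

Lemma xi_hom_act i j l (h : i + j = l) (a : Y i) u :
  xi_hom (mact h a u) = mact h (xi_hom a) u.
Proof.
apply: homP => p q e x /=.
have e1 : p + i + j = q by lia.
rewrite (ha_funE _ _ _ _ _ erefl e1) /= /xi_fun /=.
rewrite (ha_funE _ _ _ _ _ (xi_idx1 erefl) e1).
rewrite (ha_funE _ _ _ _ _ (xi_idx2 erefl) e1).
rewrite (linD (dact_linl (bact2P U) _ _)) !(linZ (dact_linl (bact2P U) _ _)).
rewrite scalerDr !scalerA -!ksignD -h; congr (_ *: _ + _ *: _).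
  by apply: (@ksign_even _ _ _ (j * (s + 1))); ring.
by apply: (@ksign_even _ _ _ (j * s)); ring.
Qed.

Lemma xi_hom_lin n : linear (@xi_hom n).
Proof.
move=> c a b; apply: homP => p q h x; rewrite homDE homZE /= /xi_fun.
pose v1 (a : Y n) := (a.1 : hom N (bimod1 U) (n + s' + 1)) _ q (xi_idx2 h) x.2.
pose v2 (a : Y n) := (a.2 : hom M (bimod1 U) (n + s')) _ q (xi_idx1 h) x.1.
exact: (comb_linear _ _ c (v2 a) (v2 b) (v1 a) (v1 b)).
Qed.

Definition xi : dgmap Y (hom_bimod U X) :=
  @DgMap k S Y (hom_bimod U X) xi_hom xi_hom_lin xi_hom_d xi_hom_act.

Lemma sgn_eq0 (V : lmodType k) n (v : V) : ksign k n *: v = 0 -> v = 0.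
Proof. by move=> e; rewrite -[v]scale1r -(ksignK k n) -scalerA e scaler0. Qed.

Lemma xi_inj n (a : Y n) : xi n a = 0 -> a = 0.
Proof.
case: a => a1 a2 e; congr (_, _); apply: homP => p q h x; rewrite hom0E.
- have E : (p - s) + s = p by lia.
  case: _ / E x h => x h; have h' : p - s + n = q by lia.
  have := congr1
    (fun g : hom X (bimod1 U) n => g _ q h' ((0, x) : X (p - s))) e.
  rewrite /= /xi_fun /= (lin0 (hf_lin (a2 : hom M (bimod1 U) (n + s')) _)).
  rewrite scaler0 add0r (eq_irrelevance (xi_idx2 h') h).
  exact: sgn_eq0.
- have E : (p - s - 1) + s + 1 = p by lia.
  case: _ / E x h => x h; have h' : p - s - 1 + n = q by lia.
  have := congr1
    (fun g : hom X (bimod1 U) n => g _ q h' ((x, 0) : X (p - s - 1))) e.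
  rewrite /= /xi_fun /= (lin0 (hf_lin (a1 : hom N (bimod1 U) (n + s' + 1)) _)).
  rewrite scaler0 addr0 (eq_irrelevance (xi_idx1 h') h).
  exact: sgn_eq0.
Qed.

Lemma mcast_pair p p' (e : p = p') (e1 : p + s + 1 = p' + s + 1)
    (e2 : p + s = p' + s) (x1 : M (p + s + 1)) (x2 : N (p + s)) :
  mcast (N := X) e (x1, x2) = (mcast e1 x1, mcast e2 x2).
Proof. by case: _ / e e1 e2 => e1 e2; rewrite !mcast_id. Qed.

Section Surj.
Context (n : int) (b : hom X (bimod1 U) n).

Lemma xi_idx3 p q : p + (n + s' + 1) = q -> p - s + n = q.
Proof. lia. Qed.
Lemma xi_idx4 p : p = p - s + s.
Proof. lia. Qed.
Lemma xi_idx5 p q : p + (n + s') = q -> p - s - 1 + n = q.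
Proof. lia. Qed.
Lemma xi_idx6 p : p = p - s - 1 + s + 1.
Proof. lia. Qed.

Definition xi_inv1 : hom N (bimod1 U) (n + s' + 1).
Proof.
exists (fun p q h x => ksign k (n * s) *:
  b _ q (xi_idx3 h) ((0, mcast (xi_idx4 p) x) : X (p - s))).
- move=> p q h c x y; have -> : ((0, mcast (xi_idx4 p) (c *: x + y)) : X (p - s))
    = c *: ((0, mcast (xi_idx4 p) x) : X (p - s))
      + ((0, mcast (xi_idx4 p) y) : X (p - s)).
    by rewrite (mcast_lin (xi_idx4 p)); congr (_, _); rewrite /= scaler0 addr0.
  by rewrite (hf_lin b) scalerDr !scalerA (mulrC c).
- move=> p q j p' q' h hp hq h' x c /=.
  have hp' : p - s + j = p' - s by lia.
  rewrite (linZ (dact_linl (bact1P U) _ _)).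
  rewrite -[bact1 _ _ _](hf_act b (xi_idx3 h) hp' hq (xi_idx3 h')) /=.
  rewrite (lin0 (dact_linl (mactP M) _ _)).
  by rewrite (mcast_act (xi_idx4 p) (xi_idx4 p') hp).
Defined.

Definition xi_inv2 : hom M (bimod1 U) (n + s').
Proof.
exists (fun p q h x => ksign k ((n + 1) * (s + 1)) *:
  b _ q (xi_idx5 h) ((mcast (xi_idx6 p) x, 0) : X (p - s - 1))).
- move=> p q h c x y.
  have -> : ((mcast (xi_idx6 p) (c *: x + y), 0) : X (p - s - 1))
    = c *: ((mcast (xi_idx6 p) x, 0) : X (p - s - 1))
      + ((mcast (xi_idx6 p) y, 0) : X (p - s - 1)).
    by rewrite (mcast_lin (xi_idx6 p)); congr (_, _); rewrite /= scaler0 addr0.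
  by rewrite (hf_lin b) scalerDr !scalerA (mulrC c).
- move=> p q j p' q' h hp hq h' x c /=.
  have hp' : p - s - 1 + j = p' - s - 1 by lia.
  rewrite (linZ (dact_linl (bact1P U) _ _)).
  rewrite -[bact1 _ _ _](hf_act b (xi_idx5 h) hp' hq (xi_idx5 h')) /=.
  rewrite (lin0 (dact_linl (mactP N) _ _)).
  by rewrite (mcast_act (xi_idx6 p) (xi_idx6 p') hp).
Defined.
End Surj.

Lemma xi_surj n (b : hom_bimod U X n) : exists a, xi n a = b.
Proof.
exists ((xi_inv1 b, xi_inv2 b) : Y n); apply: homP => p q h [x1 x2].
rewrite /= /xi_fun /= !scalerA !ksignK !scale1r.
have e1 : p = p + s + 1 - s - 1 by lia.
have e2 : p = p + s - s by lia.
have h1 : p + s + 1 - s - 1 + s + 1 = p + s + 1 by lia.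
have -> : (mcast (xi_idx6 (p + s + 1)) x1, 0) =
  mcast (N := X) e1 (x1, 0).
  rewrite (mcast_pair _ (xi_idx6 (p + s + 1))); first by lia.
  by move=> e3; rewrite (lin0 (mcast_lin _)).
have -> : (0, mcast (xi_idx4 (p + s)) x2) = mcast (N := X) e2 (0, x2).
  rewrite (mcast_pair _ _ (xi_idx4 (p + s))); first by lia.
  by move=> e3; rewrite (lin0 (mcast_lin _)).
rewrite !(hf_mcast _ _ h) -(linD (hf_lin b _)); congr (b _ _ _ _).
by congr (_, _); rewrite /= ?addr0 ?add0r.
Qed.

Lemma xi_qi : quasi_iso xi.
Proof. by apply: bij_qi => n; [apply: xi_inj|apply: xi_surj]. Qed.
End Xi.

(** * The derived functor of Hom(-, U) *)

Section HomPre.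
Context (k : comPzRingType) (A S : dgalg k) (U : dgbimod A S).
Implicit Types M N P : dgmod A.

Lemma hom_pre_id M : hom_pre U (dgid M) = dgid (hom_bimod U M).
Proof. by apply: dgmapP => n a; apply: homP. Qed.

Lemma hom_pre_comp M N P (g : dgmap N P) (f : dgmap M N) :
  hom_pre U (dgcomp g f) = dgcomp (hom_pre U f) (hom_pre U g).
Proof. by apply: dgmapP => n a; apply: homP. Qed.

(** [xi] requires a bimodule as target, and [V] is one over its own endomorphism algebra.
    Destructing [V] makes the underlying module of that bimodule convertible to [V]. *)
Lemma kproj_cone M N (f : dgmap M N) s s' : s + s' + 1 = 0 ->
  kproj M -> kproj N -> kproj (shiftn s (cone f)).
Proof.
move=> ss' kM kN V; case: V => C a aP aV.
apply: ((acyc_transfer (@xi_qi _ _ _ (end_bimod (DgMod aP)) _ _ f _ _ ss')).1).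
by apply/acyc_shiftn/acyc_cone; [apply: kN|apply: kM].
Qed.

(** By [xi] at [(-1, 0)], the cone of [hom_pre U t] is Hom out of the shifted cone of [t]. That
    module is K-projective and acyclic, hence contractible. *)
Lemma hom_pre_qi M N (t : dgmap M N) :
  kproj M -> kproj N -> quasi_iso t -> quasi_iso (hom_pre U t).
Proof.
move=> kM kN /qi_acyc_cone ac; apply/qi_acyc_cone.
apply: ((acyc_transfer (unshiftn0_qi (cone (hom_pre U t)))).1).
apply: ((acyc_transfer (@xi_qi _ _ _ U _ _ t (- 1) 0 erefl)).2).
apply: acyc_kproj_hom; last exact: acyc_shiftn.
exact: (kproj_cone _ (s' := 0)).
Qed.

Lemma kproj_repl M : kproj (repl M).
Proof. exact/cofibrant_kproj/repl_cofibrant. Qed.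

Definition homr M : dgmod S := hom_bimod U (repl M).
Definition homrf M N (f : dgmap M N) : dgmap (homr N) (homr M) :=
  hom_pre U (replf f).

Lemma homrf_id M : homrf (dgid M) = dgid (homr M).
Proof. by rewrite /homrf replf_id hom_pre_id. Qed.

Lemma homrf_comp M N P (g : dgmap N P) (f : dgmap M N) :
  homrf (dgcomp g f) = dgcomp (homrf f) (homrf g).
Proof. by rewrite /homrf replf_comp hom_pre_comp. Qed.

Lemma homrf_qi M N (f : dgmap M N) : quasi_iso f -> quasi_iso (homrf f).
Proof.
by move=> q; apply: hom_pre_qi; [exact: kproj_repl..|exact: replf_qi].
Qed.

Fixpoint dhomr M N (f : dhom M N) : dhom (homr N) (homr M) :=
  match f with
  | dloc _ _ f => dloc (homrf f)
  | dinv _ _ _ qs => dinv (homrf_qi qs)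
  | dcomp _ _ _ g f => dcomp (dhomr f) (dhomr g)
  end.

Lemma dhomr_deq M N (f g : dhom M N) : deq f g -> deq (dhomr f) (dhomr g).
Proof.
elim=> {M N f g} /=.
- by move=> *; apply: deq_refl.
- by move=> *; apply: deq_sym.
- by move=> M N f g h _ fg _; apply: deq_trans.
- by move=> *; apply: deq_congr.
- by move=> *; apply/deq_sym/deq_assoc.
- by move=> M N f; rewrite homrf_id; apply: deq_idr.
- by move=> M N f; rewrite homrf_id; apply: deq_idl.
- by move=> M N P f g; rewrite homrf_comp; apply: deq_loc.
- by move=> M N s qs; rewrite homrf_id; apply: deq_invr.
- by move=> M N s qs; rewrite homrf_id; apply: deq_invl.
Qed.

Lemma dhomr_diso M N (f : dhom M N) : is_diso f -> is_diso (dhomr f).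
Proof.
case=> g [/dhomr_deq gf /dhomr_deq fg]; exists (dhomr g) => /=.
by move: gf fg; rewrite /= !homrf_id.
Qed.

Lemma disom_homr M N : disom M N -> disom (homr M) (homr N).
Proof. by case=> f /dhomr_diso df; apply: disom_sym; exists (dhomr f). Qed.

Lemma homr_kproj P : kproj P -> disom (hom_bimod U P) (homr P).
Proof.
move=> kP; apply: (qi_disom (s := hom_pre U (eps P))); apply: hom_pre_qi => //.
  exact: kproj_repl.
exact: eps_qi.
Qed.
End HomPre.

(** * Cones and retracts in thick subcategories *)

Section Thick.
Context (k : comPzRingType) (A : dgalg k).
Implicit Types (M N P : dgmod A) (T : dgmod A -> Prop).

Lemma shiftf_id M : shiftf (dgid M) = dgid (shift M).
Proof. exact: dgmapP. Qed.

Lemma thick_cone_map T M N (f : dgmap M N) :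
  is_thick T -> T M -> T N -> T (cone f).
Proof.
move=> tT; apply: (thick_cone tT (u := dloc f) (v := dloc (cone_in f))
  (w := dloc (cone_out f))).
exists M, N, f, (did M), (did N), (did (cone f)); do 2!split.
- exact: diso_id.
- exact: diso_id.
- exact: diso_id.
- exact: deq_trans (deq_idl _) (deq_sym (deq_idr _)).
- exact: deq_trans (deq_idl _) (deq_sym (deq_idr _)).
- rewrite /= shiftf_id.
  exact: deq_trans (deq_idl _) (deq_sym (deq_idr _)).
Qed.

Definition dgpair P M N (f : dgmap P M) (g : dgmap P N) : dgmap P (dgsum M N).
Proof.
exists (fun i x => (f i x, g i x) : dgsum M N i).
- by move=> i c x y; rewrite (mf_lin f) (mf_lin g).
- by move=> i j h x /=; rewrite !mf_d.
- by move=> i j l h x c /=; rewrite !mf_act.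
Defined.

Definition dgsum_inl M N : dgmap M (dgsum M N).
Proof.
exists (fun i x => (x, 0) : dgsum M N i).
- by move=> i c x y /=; congr (_, _); rewrite /= scaler0 addr0.
- by move=> i j h x /=; rewrite (lin0 (cd_lin _)).
- by move=> i j l h x c /=; rewrite (lin0 (dact_linl (mactP N) _ _)).
Defined.

Definition dgsum_fst M N : dgmap (dgsum M N) M.
Proof. by exists (fun i (x : dgsum M N i) => x.1). Defined.

Lemma dgsum_fst_inl M N : dgcomp (dgsum_fst M N) (dgsum_inl M N) = dgid M.
Proof. exact: dgmapP. Qed.

Lemma dgsum_cycle M N i (x : dgsum M N i) : cd (erefl (i + 1)) x = 0 <->
  cd (erefl (i + 1)) (x.1 : M i) = 0 /\ cd (erefl (i + 1)) (x.2 : N i) = 0.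
Proof.
split=> [e|[e1 e2]]; last by rewrite /= e1 e2.
by split; [apply: (congr1 fst e)|apply: (congr1 snd e)].
Qed.

Lemma dgsum_coh M N i (x y : dgsum M N i) :
  coh x y <-> coh (x.1 : M i) y.1 /\ coh (x.2 : N i) y.2.
Proof.
split=> [[h [e [z ->]]]|].
  by split; [apply: (@cohI _ _ _ _ _ _ e z.1)|apply: (@cohI _ _ _ _ _ _ e z.2)].
case: x y => x1 x2 [y1 y2] /= [[h [e [z ->]]] /(cohE e) [z' ->]].
exact: (@cohI _ (dgsum M N) _ _ _ _ e ((z, z') : dgsum M N h)).
Qed.

(* A retraction [p] of [s : X -> Y] splits [Y] as [X (+) cone s]. *)
Lemma thick_retract T (X Y : dgmod A) (s : dgmap X Y) (p : dgmap Y X) :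
  is_thick T -> dgcomp p s = dgid X -> T Y -> T X.
Proof.
move=> tT ps TY; have psE i x : p i (s i x) = x.
  exact: (congr1 (fun g : dgmap X X => g i x) ps).
apply: (thick_summand tT (N := cone s)); apply: (thick_iso tT) TY.
apply: (qi_disom (s := dgpair p (cone_in s))); apply/quasi_isoE; split=> i.
  have E : (i - 1) + 1 = i by lia.
  case: _ / E => y dy /dgsum_coh [/= /(cohE erefl) [w]].
  rewrite add0r => py /cone_coh0 [u1 [u2 [/= /eqP e1 ey]]].
  have {}e1 : cd erefl u1 = 0 by apply/eqP; move: e1; rewrite eq_sym oppr_eq0.
  (* Applying [p] to [y = s u1 + d u2] gives [u1 = d (w - p u2)]. *)
  apply: (@cohI _ _ _ _ _ _ erefl (s _ (w - p _ u2) + u2)).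
  rewrite add0r ey (linD (cd_lin _)) -mf_d (linB (cd_lin _)) -mf_d -py ey.
  by congr (s _ _ + _); rewrite mfD psE [RHS]addrK.
move=> x /dgsum_cycle []; have E : (i - 1) + 1 = i by lia.
case: _ / E x => -[x [x1 x2]] /= dx /cone_cycle [/= dx1 dx2].
have ex1 : x1 = - cd erefl (p _ x2).
  apply/eqP; rewrite -addr_eq0 -[x1]psE -mf_d -mfD; apply/eqP.
  by rewrite dx2 mf0.
(* Its image under [p] is [x], and in the cone it differs from [(x1, x2)] by the boundary of
   [(p x2 - x, 0)]. *)
exists (x2 - s _ (p _ x2) + s _ x).
  rewrite (linD (cd_lin _)) (linB (cd_lin _)) -!mf_d dx mf0 addr0.
  have -> : p _ (cd erefl x2) = - x1 by rewrite ex1 opprK mf_d.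
  by rewrite mfN opprK [LHS]addrC.
apply/(@dgsum_coh X (cone s)); split=> /=.
  by rewrite mfD mfB !psE subrr add0r; apply: coh_refl.
apply/coh_subr0/cone_coh0; exists (p _ x2 - x), 0; split=> /=.
  by rewrite subr0 (linB (cd_lin _)) dx subr0.
rewrite (lin0 (cd_lin _)) addr0 mfB.
exact: zmod_eq4.
Qed.
End Thick.

(** * Preimages of thick subcategories under RHom *)

Section HomThick.
Context (k : comPzRingType) (A S : dgalg k) (U : dgbimod A S).
Implicit Types M N P : dgmod A.

(** A K-projective resolution of [cone f] that is itself a cone, unlike [repl (cone f)]; the shift
    by 0 gives it the shape of the source in [xi]. *)
Definition repl_cone M N (f : dgmap M N) :
  dgmap (shiftn 0 (cone (replf f))) (cone f) :=
  dgcomp (conemap (eps_nat f)) (unshiftn0 _).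

Lemma repl_cone_qi M N (f : dgmap M N) : quasi_iso (repl_cone f).
Proof.
by apply: qi_comp (unshiftn0_qi _) _; apply: conemap_qi; apply: eps_qi.
Qed.

Lemma repl_cone_surj M N (f : dgmap M N) i y : exists x, repl_cone f i x = y.
Proof.
case: y => y1 y2; have [x1 <-] := eps_surj y1; have [x2 <-] := eps_surj y2.
have [x ex] := unshiftn0_surj ((x1, x2) : cone (replf f) i).
by exists x; rewrite -[LHS]/(conemap (eps_nat f) i (unshiftn0 _ i x)) ex.
Qed.

Lemma repl_cone_kproj M N (f : dgmap M N) :
  kproj (shiftn 0 (cone (replf f))).
Proof. by apply: (kproj_cone _ (s' := - 1)) => //; apply: kproj_repl. Qed.

(** Contravariance turns a cone into a cocone: this is [xi] at [(0, -1)], applied to the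
    replacements. *)
Lemma homr_cone M N (f : dgmap M N) :
  disom (shiftn (- 1) (cone (homrf U f))) (homr U (cone f)).
Proof.
have q := @xi_qi _ _ _ U _ _ (replf f) 0 (- 1) erefl.
apply: (disom_trans (qi_disom q)).
apply: (disom_trans (homr_kproj U (@repl_cone_kproj _ _ f))).
exact/disom_homr/qi_disom/repl_cone_qi.
Qed.

Lemma acyc_homr M : acyc M -> acyc (homr U M).
Proof.
move=> aM; apply: acyc_kproj_hom; first exact: kproj_repl.
exact: (acyc_transfer (eps_qi M)).2.
Qed.

(* Cones of identities play the role of a zero object below. *)
Lemma acyc_cone_id M : acyc (cone (dgid M)).
Proof. exact/qi_acyc_cone/dgid_quasi_iso. Qed.

(** Reduces closure under shifts to statements about cones of dg-maps. *)
Lemma cone_cone_in_disom M : disom (cone (cone_in (dgid M))) (shift M).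
Proof. exact/qi_disom/cone_out_qi/acyc_cone_id. Qed.

Lemma thick_homr (T : dgmod S -> Prop) :
  is_thick T -> is_thick (fun M => T (homr U M)).
Proof.
move=> tT.
have Tiso X Y : disom X Y -> T X <-> T Y.
  by move=> XY; split; apply: (thick_iso tT) => //; apply: disom_sym.
have Tuns X : T (shiftn (- 1) X) <-> T X.
  rewrite (thick_shift tT); apply: Tiso.
  exact/qi_disom/shift_unshift_qi.
have Tcone M N (f : dgmap M N) : T (homr U (cone f)) <-> T (cone (homrf U f)).
  by rewrite -(Tiso _ _ (homr_cone f)).
split.
- by move=> M N /(disom_homr U) /Tiso ->.
- move=> M; rewrite -(Tiso _ _ (disom_homr U (cone_cone_in_disom M))) Tcone.
  (* The source of the map whose cone is taken is acyclic, so the cone is isomorphic to its target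
     [homr U M]. *)
  apply/Tiso/(qi_disom (s := cone_in _))/cone_in_qi/acyc_homr/acyc_cone_id.
- move=> X Y Z u v w [M [N [f [a [b [c [[da db dc] _]]]]]]] TX TY.
  have /(disom_homr U)/Tiso -> : disom Z (cone f) by exists c.
  apply/Tcone/(thick_cone_map _ tT).
    by apply/(Tiso _ (homr U Y)) => //; apply/disom_homr/disom_sym; exists b.
  by apply/(Tiso _ (homr U X)) => //; apply/disom_homr/disom_sym; exists a.
- move=> M N TMN.
  (* Functoriality exhibits [homr U M] as a retract of the image of the sum, which avoids comparing
     that image with a sum. *)
  apply: (@thick_retract _ _ _ _ _ (homrf U (dgsum_fst M N))
    (homrf U (dgsum_inl M N)) tT _ TMN).
  by rewrite -homrf_comp -homrf_id dgsum_fst_inl.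
Qed.

Lemma thick_homr_map M N : thick M N -> thick (homr U M) (homr U N).
Proof. by move=> tMN T /thick_homr tT TM; apply: tMN tT TM. Qed.
End HomThick.

(** * Reflexive modules *)

Lemma deq_cancel_r (k : comPzRingType) (A : dgalg k) (M N P : dgmod A)
    (x y : dhom N P) (e : dhom M N) :
  is_diso e -> deq (dcomp x e) (dcomp y e) -> deq x y.
Proof.
move=> [e' [_ ee']] xy; apply: deq_trans (deq_sym (dcompKr x ee')) _.
by apply: deq_trans (dcompKr y ee'); apply: deq_comp2r.
Qed.

Section Evaluation.
Context (k : comPzRingType) (A S : dgalg k) (U : dgbimod A S).

Lemma ev_nat (P P' : dgmod A) (V V' : dgmod S) (t : dgmap P' P)
    (v : dgmap V V') (r : dgmap V (hom_bimod U P))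
    (r' : dgmap V' (hom_bimod U P')) :
  dgcomp r' v = dgcomp (hom_pre U t) r ->
  dgcomp (hom_pre (bimod_swap U) v) (ev r') = dgcomp (ev r) t.
Proof.
move=> sq; apply: dgmapP => i x; apply: homP => p q h y /=.
rewrite /ev_fun; congr (_ *: _).
exact: (congr1 (fun g : dgmap V (hom_bimod U P') =>
  (g p y : hom P' (bimod1 U) p) i q (eq_addC h) x) sq).
Qed.

Section Cone.
Context (P1 P2 : dgmod A) (f : dgmap P1 P2) (V1 V2 : dgmod S) (g : dgmap V2 V1).
Context (r1 : dgmap V1 (hom_bimod U P1)) (r2 : dgmap V2 (hom_bimod U P2)).
Hypothesis sq : dgcomp r1 g = dgcomp (hom_pre U f) r2.

Lemma ev_sq :
  dgcomp (ev r2) f = dgcomp (hom_pre (bimod_swap U) g) (ev r1).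
Proof. exact/esym/ev_nat. Qed.

(** The unit on a cone is the cone of the units: with [s = 0] and [s' = -1], the signs of both maps
    [xi] match those of [ev] exactly. *)
Lemma ev_xi (s s' : int) (ss' : s + s' + 1 = 0) (s's : s' + s + 1 = 0) :
  s = 0 ->
  ev (dgcomp (xi U f ss') (shiftnf s' (conemap sq)))
  = dgcomp (xi (bimod_swap U) g s's) (shiftnf s (conemap ev_sq)).
Proof.
move=> s0; have s'1 : s' = - 1 by lia.
apply: dgmapP => i x; apply: homP => p q h v.
rewrite /= /ev_fun /= /xi_fun /= /ev_fun scalerDr !scalerA -!ksignD addrC.
congr (_ *: _ + _ *: _).
- by rewrite s0 s'1; congr ksign; ring.
- by congr (_ _ _); apply: eq_irrelevance.
- by rewrite s0 s'1; apply: (@ksign_even _ _ _ (i + 1)); ring.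
- by congr (_ _ _); apply: eq_irrelevance.
Qed.
End Cone.

Definition evr M : dgmap (repl M) (homr (bimod_swap U) (homr U M)) :=
  ev (eps (homr U M)).

Lemma evr_nat M N (f : dgmap M N) :
  dgcomp (homrf (bimod_swap U) (homrf U f)) (evr M) = dgcomp (evr N) (replf f).
Proof. exact/ev_nat/eps_nat. Qed.

Definition unitr M : dhom M (homr (bimod_swap U) (homr U M)) :=
  dcomp (dloc (evr M)) (dinv (eps_qi M)).

Lemma unitr_eps M : deq (dcomp (unitr M) (dloc (eps M))) (dloc (evr M)).
Proof. exact/dcompKr/deq_invl. Qed.

(** Induction on formal composites; the square for a formal inverse follows from that for the
    quasi-isomorphism itself by cancellation. *)
Lemma unitr_nat M N (f : dhom M N) :
  deq (dcomp (dhomr (bimod_swap U) (dhomr U f)) (unitr M)) (dcomp (unitr N) f).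
Proof.
have nat_loc X Y (g : dgmap X Y) :
    deq (dcomp (dhomr (bimod_swap U) (dhomr U (dloc g))) (unitr X))
      (dcomp (unitr Y) (dloc g)).
  (* Precomposing with [eps X] removes the formal inverse from the unit, and the strict squares
     [evr_nat] and [eps_nat] apply. *)
  apply: (deq_cancel_r (diso_loc (eps_qi X))).
  apply: deq_trans (deq_sym (deq_assoc _ _ _)) _.
  apply: deq_trans (deq_comp2l _ (unitr_eps X)) _.
  apply: deq_trans (deq_sym (deq_loc _ _)) _; rewrite evr_nat.
  apply: deq_trans (deq_loc _ _) _.
  apply: deq_trans (deq_comp2r _ (deq_sym (unitr_eps Y))) _.
  apply: deq_trans (deq_sym (deq_assoc _ _ _)) _.
  apply: deq_trans (deq_assoc _ _ _).
  apply: deq_comp2l; apply: deq_trans (deq_sym (deq_loc _ _)) _.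
  by rewrite eps_nat; apply: deq_loc.
elim: f => {M N} [//|X Y s qs|X Y Z g IHg f IHf].
- apply: (deq_cancel_r (diso_loc qs)).
  apply: deq_trans (deq_sym (deq_assoc _ _ _)) _.
  apply: deq_trans (deq_comp2l _ (deq_sym (nat_loc _ _ s))) _.
  apply: deq_trans (deq_sym (dcompKr _ (deq_invl qs))).
  exact/dcompKl/deq_invl.
- apply: deq_trans (deq_sym (deq_assoc _ _ _)) _.
  apply: deq_trans (deq_comp2l _ IHf) _.
  apply: deq_trans (deq_assoc _ _ _) _.
  apply: deq_trans (deq_comp2r _ IHg) _.
  exact/deq_sym/deq_assoc.
Qed.

Definition reflexive M : Prop := is_diso (unitr M).

Lemma reflexive_qi M : reflexive M <-> quasi_iso (evr M).
Proof.
split=> [r|/diso_loc r].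
  apply: diso_qi; apply: diso_deq (unitr_eps M) _.
  by apply: diso_comp => //; apply/diso_loc/eps_qi.
by apply: diso_comp => //; apply: diso_dinv.
Qed.

Lemma reflexive_iso M N : disom M N -> reflexive M -> reflexive N.
Proof.
move=> [f df] rM; apply: (diso_cancel_r df); apply: diso_deq (unitr_nat f) _.
by apply: diso_comp rM _; do 2!apply: dhomr_diso.
Qed.

(** The inverse at [M] is the inverse at [N] preceded by the double dual of [i] and followed by [p].
    Naturality for [i] handles one composite, naturality for [p] the other. *)
Lemma reflexive_retract M N (i : dgmap M N) (p : dgmap N M) :
  dgcomp p i = dgid M -> reflexive N -> reflexive M.
Proof.
move=> pi [e [eN Ne]].
pose E X Y (f : dhom X Y) := dhomr (bimod_swap U) (dhomr U f).
have Epi : deq (dcomp (E _ _ (dloc p)) (E _ _ (dloc i))) (did _).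
  apply: deq_trans (deq_sym (deq_loc _ _)) _.
  by rewrite -!homrf_comp pi !homrf_id; apply: deq_refl.
exists (dcomp (dloc p) (dcomp e (E _ _ (dloc i)))); split.
  apply: deq_trans (deq_sym (deq_assoc _ _ _)) _.
  apply: deq_trans (deq_comp2l _ (deq_sym (deq_assoc _ _ _))) _.
  apply: deq_trans (deq_comp2l _ (deq_comp2l _ (unitr_nat (dloc i)))) _.
  apply: deq_trans (deq_comp2l _ (dcompKl _ eN)) _.
  by apply: deq_trans (deq_sym (deq_loc _ _)) _; rewrite pi; apply: deq_refl.
apply: deq_trans (deq_assoc _ _ _) _.
apply: deq_trans (deq_comp2r _ (deq_sym (unitr_nat (dloc p)))) _.
apply: deq_trans (deq_sym (deq_assoc _ _ _)) _.
by apply: deq_trans (deq_comp2l _ (dcompKl _ Ne)) Epi.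
Qed.

(** Reflexivity can be tested on any K-projective resolutions. Cofibrancy of [repl] lifts comparison
    maps [t] and [v] to the given ones, and [ev_nat] relates the two evaluations. Surjectivity of
    [p] is what the lifting property asks for. *)
Lemma reflexive_resolution M (P : dgmod A) (p : dgmap P M) (V : dgmod S)
    (r : dgmap V (hom_bimod U P)) :
  kproj P -> (forall i y, exists x, p i x = y) -> quasi_iso p ->
  kproj V -> quasi_iso r -> reflexive M <-> quasi_iso (ev r).
Proof.
move=> kP ps pq kV rq.
have [t /dgmapP et] : exists t, forall i x, dgcomp p t i x = eps M i x.
  exact: repl_cofibrant ps pq (eps M).
have tq : quasi_iso t.
  by apply: (qi_cancel_l pq); rewrite et; apply: eps_qi.
(* [V] is only K-projective, so the second lift has to start from [repl V]. *)
pose r' := dgcomp r (eps V).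
have r'q : quasi_iso r' by apply: qi_comp rq; apply: eps_qi.
have [v /dgmapP ve] : exists v, forall i x,
    dgcomp (eps (homr U M)) v i x = dgcomp (hom_pre U t) r' i x.
  exact: repl_cofibrant (@eps_surj _ _ _) (eps_qi _) (dgcomp (hom_pre U t) r').
have vq : quasi_iso v.
  apply: (qi_cancel_l (eps_qi _)); rewrite ve; apply: qi_comp r'q _.
  by apply: hom_pre_qi => //; apply: kproj_repl.
have e1 := ev_nat ve.
have e2 : dgcomp (hom_pre (bimod_swap U) (eps V)) (ev r)
    = dgcomp (ev r') (dgid P).
  by apply: ev_nat; rewrite hom_pre_id; apply: dgmapP.
have pvq : quasi_iso (hom_pre (bimod_swap U) v).
  by apply: hom_pre_qi vq; apply: kproj_repl.
have peq : quasi_iso (hom_pre (bimod_swap U) (eps V)).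
  by apply: hom_pre_qi (eps_qi V) => //; apply: kproj_repl.
have -> : quasi_iso (ev r) <-> quasi_iso (ev r').
  split=> q.
    apply: (qi_cancel_r (dgid_quasi_iso P)); rewrite -e2.
    exact: qi_comp q peq.
  apply: (qi_cancel_l peq); rewrite e2.
  exact: qi_comp (dgid_quasi_iso P) q.
rewrite reflexive_qi; split=> q.
  by apply: (qi_cancel_r tq); rewrite -e1; apply: qi_comp q pvq.
apply: (qi_cancel_l pvq); rewrite e1.
exact: qi_comp tq q.
Qed.

Lemma evr_sq M N (f : dgmap M N) :
  dgcomp (evr N) (replf f) =
  dgcomp (hom_pre (bimod_swap U) (replf (homrf U f))) (evr M).
Proof. exact/esym/evr_nat. Qed.

(** The unit on [cone f] is computed with cones of replacements as resolutions on both sides, where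
    [ev_xi] identifies it. *)
Lemma reflexive_cone_map M N (f : dgmap M N) :
  reflexive (cone f) <-> quasi_iso (conemap (evr_sq f)).
Proof.
pose sq := eps_nat (homrf U f).
pose r := dgcomp (xi U (replf f) (s := 0) (s' := - 1) erefl)
  (shiftnf (- 1) (conemap sq)).
have rq : quasi_iso r.
  apply: qi_comp; last exact: xi_qi.
  by apply/shiftnf_qi/conemap_qi; apply: eps_qi.
rewrite (@reflexive_resolution _ _ (repl_cone f) _ r) //; last 4 first.
- exact: repl_cone_kproj.
- exact: repl_cone_surj.
- exact: repl_cone_qi.
- by apply: (kproj_cone _ (s' := 0)) => //; apply: kproj_repl.
rewrite /r (@ev_xi _ _ _ _ _ _ _ _ sq 0 (- 1) erefl erefl) //.
rewrite (Prop_irrelevance (ev_sq sq) (evr_sq f)).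
have e : dgcomp (unshiftn0 _) (shiftnf 0 (conemap (evr_sq f)))
    = dgcomp (conemap (evr_sq f)) (unshiftn0 _).
  apply: dgmapP => i x.
  exact: esym (mf_mcast (conemap (evr_sq f)) (addr0 i) x).
split=> q.
  apply: (qi_cancel_r (unshiftn0_qi _)); rewrite -e.
  apply: qi_comp (unshiftn0_qi _).
  exact: qi_cancel_l (xi_qi _ _ _) q.
by apply: qi_comp (xi_qi _ _ _); apply: shiftnf_qi.
Qed.

Lemma reflexive_thick : is_thick reflexive.
Proof.
split.
- exact: reflexive_iso.
- move=> M; pose z := cone_in (dgid M).
  have -> : reflexive (shift M) <-> reflexive (cone z).
    have zM := cone_cone_in_disom M.
    by split; apply: reflexive_iso => //; apply: disom_sym.
  rewrite reflexive_cone_map reflexive_qi.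
  have aZ : acyc (cone (dgid M)) by exact: acyc_cone_id.
  (* The targets of both maps are acyclic, so the projections identify the map of cones with the
     shift of [evr M]. *)
  have o1 : quasi_iso (cone_out (replf z)).
    exact/cone_out_qi/((acyc_transfer (eps_qi _)).2 aZ).
  have o2 : quasi_iso (cone_out (hom_pre (bimod_swap U) (replf (homrf U z)))).
    by apply: cone_out_qi; do 2!apply: acyc_homr.
  have e : dgcomp (cone_out _) (conemap (evr_sq z))
      = dgcomp (shiftf (evr M)) (cone_out _) by apply: dgmapP.
  split=> q.
    apply: (qi_cancel_l o2); rewrite e.
    exact: qi_comp o1 (shiftf_quasi_iso q).
  apply/shiftf_qi_inv/(qi_cancel_r o1); rewrite -e.
  exact: qi_comp q o2.
- move=> X Y Z u v w [M [N [f [a [b [c [[da db dc] _]]]]]]] rX rY.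
  apply: (@reflexive_iso (cone f)); first by apply: disom_sym; exists c.
  apply/reflexive_cone_map/conemap_qi; apply/reflexive_qi.
    by apply: reflexive_iso rX; exists a.
  by apply: reflexive_iso rY; exists b.
- by move=> M N; apply/reflexive_retract/dgsum_fst_inl.
Qed.
End Evaluation.

(** * The double centralizer *)

Section DoubleCentralizer.
Context (k : comPzRingType) (A : dgalg k).

Lemma thick_disom (X X' M M' : dgmod A) :
  disom X X' -> disom M M' -> thick X M -> thick X' M'.
Proof.
move=> XX MM t T tT TX'; apply: (thick_iso tT MM); apply: (t _ tT).
exact: (thick_iso tT (disom_sym XX) TX').
Qed.

Lemma homr_dgreg S (U : dgbimod A S) : disom (homr U (dgreg A)) (bimod2 U).
Proof.
have kA : kproj (dgreg A) by apply/cofibrant_kproj/cofibrant_dgreg.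
apply: (disom_trans (disom_sym (homr_kproj U kA))); apply: disom_sym.
exact: (qi_disom (dgcomp_reg_quasi_iso (dgid_quasi_iso (bimod2 U)))).
Qed.

Section End.
Context (M : dgmod A).

Definition end_map : dgmap (dgreg (dgop (dgend M))) (hom_bimod (end_bimod M) M).
Proof.
exists (fun n (b : hom M M n) =>
  @Hom k A M (bimod1 (end_bimod M)) n b (hf_lin b) (hf_act b)).
- by move=> n c a b; apply: homP.
- by move=> i j h b; apply: homP.
- move=> i j l h a b; apply: homP => p q e x /=.
  have e1 : p + i + j = q by lia.
  rewrite (ha_funE _ _ _ _ _ erefl e1) /= /end_act.
  rewrite (hc_funE _ _ _ _ _ erefl e1) scalerA -ksignD.
  by congr (_ *: _); apply: (@ksign_even _ _ _ (- (p * j))); ring.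
Defined.

Lemma end_map_qi : quasi_iso end_map.
Proof.
apply: bij_qi => n b.
  move=> e; apply: homP => p q h x.
  exact: (congr1 (fun g : hom M (bimod1 (end_bimod M)) n => g p q h x) e).
pose b' := (b : hom M (bimod1 (end_bimod M)) n).
exists (@Hom k A M M n b' (hf_lin b') (hf_act b') : dgreg (dgop (dgend M)) n).
exact: homP.
Qed.

(** After [end_map] identifies the dual of [M] with [B], evaluation is the canonical isomorphism of
    [M] with [Hom_B(B, M)]. *)
Lemma ev_end_map_qi : quasi_iso (ev end_map).
Proof.
(* Pointwise only: the sources of the two dg-maps agree up to the eta-rule for records. *)
have E n (x : M n) :
    ev end_map n x = reg_map (bimod_swap (end_bimod M)) n x.
  apply: homP => p q h b; rewrite /= /ev_fun /= /end_act.
  by rewrite (mulrC p).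
apply: bij_qi => n x.
  move=> e; have := congr1 (fun g : hom (dgreg (dgop (dgend M))) _ n =>
    g 0 n (add0r n) (aone (dgop (dgend M)))) e.
  rewrite hom0E /= /ev_fun mul0r ksign0 scale1r.
  by rewrite -[LHS]/(h1 M n n (eq_addC (add0r n)) x) h1E.
have [u [eu _]] := reg_map_bij x.
by exists u; rewrite E.
Qed.

(* [bimod1 (end_bimod M)] is [M] up to the eta-rule for records only. *)
Definition eta_map : dgmap (bimod1 (end_bimod M)) M.
Proof. by exists (fun i (x : bimod1 (end_bimod M) i) => x : M i). Defined.

Lemma eta_map_qi : quasi_iso eta_map.
Proof. by apply: bij_qi => // i y; exists y. Qed.

(** The starting point of the thick subcategory argument: [M] resolves itself, and [B], free over
    itself, resolves its dual. *)
Lemma reflexive_end : kproj M -> reflexive (end_bimod M) M.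
Proof.
move=> kM; apply/(reflexive_resolution (p := dgid M) (r := end_map)) => //.
- by move=> i y; exists y.
- exact: dgid_quasi_iso.
- exact/cofibrant_kproj/cofibrant_dgreg.
- exact: end_map_qi.
- exact: ev_end_map_qi.
Qed.
End End.
End DoubleCentralizer.

Theorem proposition2p4 (k : comPzRingType) (A : dgalg k) (U : dgmod A)
    (U' : cofrepl U) (V : cofrepl (bimod2 (end_bimod U'))) :
  let B := dgend U' in
  let BU : dgmod (dgop B) := bimod2 (end_bimod U') in
  let delta_A : dhom (dgreg A) (rhom (bimod_swap (end_bimod U')) V) :=
    unit_reg V in
  thick U (dgreg A) <->
  (thick (dgreg (dgop B)) BU /\ is_diso delta_A).
Proof.
set E := end_bimod U'; move=> B BU delta_A.
have kU : kproj U' by exact/cofibrant_kproj/cr_cofibrant.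
have kV : kproj V by exact/cofibrant_kproj/cr_cofibrant.
have UU : disom U' U by exact/qi_disom/cr_quasi_iso.
split=> [tA|[tB dA]].
  split.
    apply: (thick_disom _ _ (thick_homr_map (U := E) tA)); last first.
      exact: homr_dgreg.
    apply: (disom_trans (disom_homr E (disom_sym UU))).
    apply: (disom_trans (disom_sym (homr_kproj E kU))).
    exact/disom_sym/qi_disom/end_map_qi.
  (* [delta_A] uses [A] as its own replacement and [V] over [B], so its evaluation map is compared
     with [unitr] by [reflexive_resolution]. *)
  apply: diso_comp; [exact: diso_dinv | apply: diso_loc].
  apply/(reflexive_resolution (p := dgid (dgreg A))).
  - exact/cofibrant_kproj/cofibrant_dgreg.
  - by move=> i y; exists y.
  - exact: dgid_quasi_iso.
  - exact: kV.
  - exact: (cr_quasi_iso (reg_cofrepl V)).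
  - apply: tA (reflexive_thick E) _.
    exact: reflexive_iso UU (reflexive_end kU).
(* The converse applies the dual functor, that of the swapped bimodule; [delta_A] identifies its
   value at [U] with [A]. *)
apply: (thick_disom _ _ (thick_homr_map (U := bimod_swap E) tB)).
  apply: (disom_trans (homr_dgreg (bimod_swap E))).
  exact: disom_trans (qi_disom (eta_map_qi U')) UU.
apply: (@disom_trans _ _ _ (hom_bimod (bimod_swap E) V)).
  apply: (disom_trans (disom_homr _ (disom_sym (qi_disom (cr_quasi_iso V))))).
  exact/disom_sym/homr_kproj.
by apply: disom_sym; exists delta_A.
Qed.
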